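(* Let $A$ be an unrooted directed tree, let $1\le p<\infty$, and let $\lambda=(\lambda_v)_{v\in A}$ be a weight such that the induced weighted backward shift $B_\lambda:\ell^p(A)\to\ell^p(A)$ is bounded. Consider the following assertions. (i) $B_\lambda$ supports a dense hypercyclic algebra. (ii) There is a dense set of elements $f\in\ell^p(A)$ generating a hypercyclic algebra for $B_\lambda$. (iii) There is a residual set of elements $f\in\ell^p(A)$ such that $f^m\in HC(B_\lambda)$ for all $m\ge1$. (iv) There is a dense set of elements $f\in\ell^p(A)$ such that $f^m\in HC(B_\lambda)$ for some integer $m\ge p$. (v) There is a sequence of non-negative integers $(n_k)_{k\ge1}$ such that, for every $v\in A$, $$\sup_{u\in\mathrm{Chi}^{n_k}(v)}|\lambda(v\to u)|\xrightarrow{k\to+\infty}+\infty$$ and $$\max\Bigg(\frac{1}{|\lambda(\mathrm{par}^{n_k}(v)\to v)|},\ \sup_{u\in\mathrm{Chi}^{n_k}(\mathrm{par}^{n_k}(v))}\frac{|\lambda(\mathrm{par}^{n_k}(u)\to u)|}{|\lambda(\mathrm{par}^{n_k}(v)\to v)|}\Bigg)\xrightarrow{k\to+\infty}+\infty.$$ Then (i) $\Rightarrow$ (ii) $\Rightarrow$ (iii) $\Leftrightarrow$ (iv) $\Leftrightarrow$ (v).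
   Context: All scalars are complex. A directed tree is a connected directed graph $(A,E)$ with countable vertex set $A$ and edge set $E\subset\{(a,b)\in A\times A: a\ne b\}$, having no cycles, and such that each vertex $b$ has at most one parent, i.e. a vertex $a=\mathrm{par}(b)$ with $(a,b)\in E$. The tree is unrooted if every vertex has a parent. $\mathrm{par}^0(b)=b$ and $\mathrm{par}^k(b)=\mathrm{par}(\mathrm{par}^{k-1}(b))$. $\mathrm{Chi}(v)$ is the set of children of $v$ (vertices whose parent is $v$), $\mathrm{Chi}^0(v)=\{v\}$, $\mathrm{Chi}^n(v)=\bigcup_{u\in\mathrm{Chi}^{n-1}(v)}\mathrm{Chi}(u)$. All trees are assumed leafless: every vertex has at least one child (possibly infinitely many). A weight is a family $\lambda=(\lambda_v)_{v\in A}$ of non-zero scalars. The weighted backward shift is $(B_\lambda f)(v)=\sum_{u\in\mathrm{Chi}(v)}\lambda_uf(u)$ for $f\in\mathbb{C}^A$, $v\in A$. For $u\in\mathrm{Chi}^n(v)$, $n\ge0$, put $\lambda(v\to u)=\prod_{k=0}^{n-1}\lambda_{\mathrm{par}^k(u)}$ (equal to $1$ if $n=0$). $\ell^p(A)$ is the space of $f\in\mathbb{C}^A$ with $\|f\|_p=(\sum_{v\in A}|f(v)|^p)^{1/p}<\infty$; it is a Banach algebra for the coordinatewise product $(fg)(v)=f(v)g(v)$, and $f^m$ is the $m$-th power for this product. $HC(T)$ is the set of hypercyclic vectors of $T$, i.e. vectors $x$ whose orbit $\{T^nx:n\ge0\}$ is dense. A hypercyclic algebra for $T$ is a subalgebra,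 not $\{0\}$, contained in $HC(T)\cup\{0\}$; it is dense if it is dense in the whole space. An element $f$ generates a hypercyclic algebra if the subalgebra generated by $f$ (all $P(f)$, $P$ a polynomial without constant term) is a hypercyclic algebra. A set is residual if it contains a dense $G_\delta$ set. *)

(* Defs.v *)
From HB Require Import structures.
From mathcomp Require Import all_boot all_order all_algebra.
From mathcomp Require Import all_classical all_reals all_analysis borel_hierarchy.
From mathcomp Require Import complex ring.
From mathcomp.analysis.showcase Require Import summability.

(* The scalar field is [R[i]] for [R : realType]; its topology is the one of the
   normed module [R[i]^o]. *)

Set Implicit Arguments.
Unset Strict Implicit.
Unset Printing Implicit Defensive.

Import Order.TTheory GRing.Theory Num.Theory numFieldNormedType.Exports.

Local Open Scope classical_set_scope.
Local Open Scope ring_scope.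
Local Open Scope complex_scope.

(* The modulus of a complex number as an element of [R]; the norm [`|z|] of
   [R[i]] takes its values in [R[i]]. *)
Notation cmod := (@Normc.normc _).

Section DirectedTree.
Variables (A : countType) (E : rel A).

(* [E a b] is the edge from [a] to [b]. Connectedness is that of the underlying
   undirected graph, and a cycle follows the direction of the edges; as a vertex
   has at most one parent, every cycle of the undirected graph is directed. *)
Record directed_tree : Prop := DirectedTree {
  tree_irrefl : irreflexive E;
  tree_connected : forall a b : A,
    exists2 s : seq A, path (fun x y => E x y || E y x) a s & last a s = b;
  tree_acyclic : forall s : seq A, s <> [::] -> ~ ucycle E s;
  tree_parent_uniq : forall a a' b : A, E a b -> E a' b -> a = a'
}.

Definition unrooted := forall b : A, exists a : A, E a b.

Definition leafless := forall a : A, exists b : A, E a b.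

(* [par b] is [b] itself when [b] has no parent. *)
Definition par (b : A) : A := xget b [set a | E a b].

Definition Chi (v : A) : set A := [set u | E v u].

Fixpoint Chin (n : nat) (v : A) : set A :=
  if n is m.+1 then \bigcup_(u in Chin m v) Chi u else [set v].

(* The product of the weights along the path of length [n] that ends at [u]:
   this is [lambda(par^n(u) -> u)], hence [lambda(v -> u)] for [u] in
   [Chin n v]. *)
Definition path_weight (R : realType) (lambda : A -> R[i]) (n : nat) (u : A) :
  R[i] := \prod_(k < n) lambda (iter k par u).

End DirectedTree.

Section LpSpace.
Variables (R : realType) (A : countType).

Definition lp_sum (p : R) (f : A -> R[i]) : \bar R :=
  (\esum_(v in [set: A]) (cmod (f v) `^ p)%:E)%E.

Definition lp_pred (p : R) (p1 : 1 <= p) : {pred A -> R[i]} :=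
  mem [set f : A -> R[i] | (lp_sum p f < +oo)%E].

Record lpspace (p : R) (p1 : 1 <= p) := LpSpace {
  lpfun :> A -> R[i];
  lpfunP : lpfun \in lp_pred p1
}.

Section theory.
Variables (p : R) (p1 : 1 <= p).

Let p0 : 0 < p. Proof. exact: lt_le_trans p1. Qed.

Lemma lp_predP (f : A -> R[i]) :
  reflect (lp_sum p f < +oo)%E (f \in lp_pred p1).
Proof. by apply: (iffP idP); rewrite inE. Qed.

Lemma cmod_ge0 (z : R[i]) : 0 <= cmod z.
Proof. by case: z => a b; exact: sqrtr_ge0. Qed.

Lemma lp_sum_ge0 (f : A -> R[i]) : (0 <= lp_sum p f)%E.
Proof. by apply: esum_ge0 => v _; rewrite lee_fin powR_ge0. Qed.

Lemma le_lp_sum (f : A -> R[i]) (v : A) : ((cmod (f v) `^ p)%:E <= lp_sum p f)%E.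
Proof.
apply: esum_ge; exists [set v]; first by split => //; exact: finite_set1.
by rewrite fsbig_set1.
Qed.

Lemma lp_sum0 : lp_sum p (fun=> 0) = 0%E.
Proof.
by apply: esum1 => v _; rewrite Normc.normc0 powR0// gt_eqF.
Qed.

Lemma esumZl_le (c : R) (a : A -> R) : 0 <= c -> (forall v, 0 <= a v) ->
  (\esum_(v in [set: A]) (c * a v)%:E <= c%:E * \esum_(v in [set: A]) (a v)%:E)%E.
Proof.
move=> c0 a0; apply: ge_ereal_sup => _ [X [finX _] <-].
under eq_fsbigr do rewrite EFinM.
rewrite -ge0_mule_fsumr; last by move=> v; rewrite lee_fin.
apply: lee_wpmul2l; first by rewrite lee_fin.
by apply: esum_ge; exists X.
Qed.

Lemma lp_sumZ_le (c : R[i]) (f : A -> R[i]) :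
  (lp_sum p (fun v => (c * f v)%R) <= (cmod c `^ p)%:E * lp_sum p f)%E.
Proof.
rewrite /lp_sum; under eq_esum do rewrite Normc.normcM powRM ?cmod_ge0//.
by apply: esumZl_le => [|v]; exact: powR_ge0.
Qed.

Lemma lp_sumM_le (f g : A -> R[i]) :
  (lp_sum p g < +oo)%E ->
  (lp_sum p (fun v => (f v * g v)%R) <= (fine (lp_sum p g))%:E * lp_sum p f)%E.
Proof.
move=> goo.
have gE : lp_sum p g \is a fin_num by rewrite ge0_fin_numE// lp_sum_ge0.
apply: (@le_trans _ _ (\esum_(v in [set: A])
    (fine (lp_sum p g) * cmod (f v) `^ p)%:E)%E).
  apply: le_esum => v _; rewrite lee_fin Normc.normcM powRM ?cmod_ge0// mulrC.
  apply: ler_wpM2r; first exact: powR_ge0.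
  by rewrite -lee_fin fineK// le_lp_sum.
apply: esumZl_le => [|v]; last exact: powR_ge0.
by rewrite fine_ge0// lp_sum_ge0.
Qed.

Lemma powR_convex (t x y : R) : 0 <= t <= 1 -> 0 <= x -> 0 <= y ->
  (t * x + (1 - t) * y) `^ p <= t * x `^ p + (1 - t) * y `^ p.
Proof.
move=> t01 x0 y0.
have /andP[t0 t1] := t01.
pose T := Itv01 t0 t1.
have := @convex_powR R p p1 T x y.
rewrite !convRE /=; apply; by rewrite inE/= in_itv/= andbT.
Qed.

Lemma lp_sumD_le (f g : A -> R[i]) (a b : R) : 0 < a -> 0 < b ->
  (lp_sum p f <= (a `^ p)%:E)%E -> (lp_sum p g <= (b `^ p)%:E)%E ->
  (lp_sum p (fun v => (f v + g v)%R) <= ((a + b) `^ p)%:E)%E.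
Proof.
move=> a0 b0 fa gb.
have ab0 : 0 < a + b by exact: addr_gt0.
pose t := a / (a + b).
have tE : 1 - t = b / (a + b).
  by rewrite /t -[X in X - _](@divff _ (a + b)) ?gt_eqF// -mulrBl addrC addKr.
have t01 : 0 <= t <= 1.
  apply/andP; split; first by rewrite divr_ge0// ltW.
  by rewrite ler_pdivrMr// mul1r lerDl ltW.
pose c := (a + b) `^ p * (t / a `^ p); pose d := (a + b) `^ p * ((1 - t) / b `^ p).
have [t0 t1] : 0 <= t /\ 0 <= 1 - t.
  by case/andP: t01 => t0 t1; split; rewrite ?subr_ge0.
have c0 : 0 <= c by apply: mulr_ge0; [|apply: divr_ge0 => //]; exact: powR_ge0.
have d0 : 0 <= d by apply: mulr_ge0; [|apply: divr_ge0 => //]; exact: powR_ge0.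
have H v : cmod (f v + g v) `^ p <= c * cmod (f v) `^ p + d * cmod (g v) `^ p.
  pose x := cmod (f v) / a; pose y := cmod (g v) / b.
  have x0 : 0 <= x by rewrite divr_ge0 ?cmod_ge0 ?ltW.
  have y0 : 0 <= y by rewrite divr_ge0 ?cmod_ge0 ?ltW.
  have xyE : (a + b) * (t * x + (1 - t) * y) = cmod (f v) + cmod (g v).
    by rewrite tE /t /x /y; field; rewrite !gt_eqF.
  apply: (@le_trans _ _ ((cmod (f v) + cmod (g v)) `^ p)).
    apply: ge0_ler_powR; rewrite ?nnegrE ?addr_ge0 ?cmod_ge0//; first exact: ltW.
    exact: le_normcD.
  rewrite -xyE powRM; last 2 first.
  - exact: ltW.
  - by apply: addr_ge0; apply: mulr_ge0.
  apply: (@le_trans _ _ ((a + b) `^ p * (t * x `^ p + (1 - t) * y `^ p))).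
    by apply: ler_wpM2l; [exact: powR_ge0|exact: powR_convex].
  have xpE : x `^ p = cmod (f v) `^ p / a `^ p.
    by apply: (canRL (mulfK _)); rewrite ?gt_eqF ?powR_gt0// -powRM ?divfK ?gt_eqF// ltW.
  have ypE : y `^ p = cmod (g v) `^ p / b `^ p.
    by apply: (canRL (mulfK _)); rewrite ?gt_eqF ?powR_gt0// -powRM ?divfK ?gt_eqF// ltW.
  rewrite xpE ypE /c /d mulrDr -!mulrA.
  by rewrite ![_^-1 * _]mulrC.
apply: (@le_trans _ _ (\esum_(v in [set: A]) (c * cmod (f v) `^ p)%:E
    + \esum_(v in [set: A]) (d * cmod (g v) `^ p)%:E)%E).
  rewrite -esumD; last 2 first.
  - by move=> v _; rewrite lee_fin mulr_ge0 ?powR_ge0.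
  - by move=> v _; rewrite lee_fin mulr_ge0 ?powR_ge0.
  by apply: le_esum => v _; rewrite lee_fin.
apply: (@le_trans _ _ (c%:E * (a `^ p)%:E + d%:E * (b `^ p)%:E)%E).
  apply: leeD.
    apply: le_trans (esumZl_le c0 _) _ => [v|]; first exact: powR_ge0.
    by apply: lee_wpmul2l; rewrite ?lee_fin.
  apply: le_trans (esumZl_le d0 _) _ => [v|]; first exact: powR_ge0.
  by apply: lee_wpmul2l; rewrite ?lee_fin.
rewrite -!EFinM -EFinD lee_fin /c /d -!mulrA !mulVf ?gt_eqF ?powR_gt0//.
by rewrite !mulr1 -mulrDr (addrC t) subrK mulr1.
Qed.

Lemma lp_sum_le_powR (f : A -> R[i]) (e : R) : 0 < e ->
  (lp_sum p f < +oo)%E ->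
  (lp_sum p f <= ((fine (lp_sum p f) `^ p^-1 + e) `^ p)%:E)%E.
Proof.
move=> e0 foo.
have fE : lp_sum p f \is a fin_num by rewrite ge0_fin_numE// lp_sum_ge0.
have f0 : 0 <= fine (lp_sum p f) by rewrite fine_ge0// lp_sum_ge0.
rewrite -[leLHS]fineK// lee_fin.
rewrite -[leLHS](@powRr1 _ (fine _))// -[X in _ `^ X](@mulVf _ p) ?gt_eqF//.
rewrite powRrM; apply: ge0_ler_powR; first exact: ltW.
- by rewrite nnegrE powR_ge0.
- by rewrite nnegrE addr_ge0 ?powR_ge0 ?ltW.
- by rewrite lerDl ltW.
Qed.

Lemma lp_submod_closed : submod_closed (lp_pred p1).
Proof.
split=> [|c f g /lp_predP foo /lp_predP goo]; apply/lp_predP.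
  by rewrite [X in (X < _)%E](_ : _ = 0%E) ?ltry// -lp_sum0.
have cfoo : (lp_sum p (fun v => (c * f v)%R) < +oo)%E.
  apply: le_lt_trans (lp_sumZ_le c f) _.
  rewrite -[X in (_ * X)%E]fineK ?ge0_fin_numE ?lp_sum_ge0//.
  by rewrite -EFinM ltry.
apply: (@le_lt_trans _ _ _ _ _ _ (ltry _)).
by apply: (@lp_sumD_le (fun v => c * f v) g _ _ _ _
  (lp_sum_le_powR ltr01 cfoo) (lp_sum_le_powR ltr01 goo));
  rewrite ltr_pwDr ?powR_ge0.
Qed.

HB.instance Definition _ := GRing.isSubmodClosed.Build R[i] (A -> R[i])
  (lp_pred p1) lp_submod_closed.

HB.instance Definition _ := [isSub for @lpfun p p1].
HB.instance Definition _ := [Choice of lpspace p1 by <:].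
HB.instance Definition _ := [SubChoice_isSubLmodule of lpspace p1 by <:].

Definition lpnorm (f : lpspace p1) : R := fine (lp_sum p f) `^ p^-1.

Lemma lpspace_fin (f : lpspace p1) : (lp_sum p f < +oo)%E.
Proof. by apply/lp_predP; exact: lpfunP. Qed.

Lemma lpnorm_le (f : lpspace p1) (a : R) : 0 <= a ->
  (lp_sum p f <= (a `^ p)%:E)%E -> lpnorm f <= a.
Proof.
move=> a0 fa.
have fE : lp_sum p f \is a fin_num by rewrite ge0_fin_numE ?lp_sum_ge0 ?lpspace_fin.
rewrite -[leRHS]powRr1// -[X in _ <= _ `^ X](@mulfV _ p) ?gt_eqF// powRrM.
apply: ge0_ler_powR; first by rewrite invr_ge0 ltW.
- by rewrite nnegrE fine_ge0// lp_sum_ge0.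
- by rewrite nnegrE powR_ge0.
- by rewrite -lee_fin fineK.
Qed.

Lemma lpnormD (f g : lpspace p1) : lpnorm (f + g) <= lpnorm f + lpnorm g.
Proof.
apply/ler_addgt0Pr => e e0.
have e20 : 0 < e / 2 by rewrite divr_gt0.
have -> : lpnorm f + lpnorm g + e = (lpnorm f + e / 2) + (lpnorm g + e / 2).
  by rewrite addrACA -splitr.
have fe : 0 < lpnorm f + e / 2 by rewrite ltr_pwDr ?powR_ge0.
have ge : 0 < lpnorm g + e / 2 by rewrite ltr_pwDr ?powR_ge0.
have fge : 0 <= lpnorm f + e / 2 + (lpnorm g + e / 2).
  by apply: ltW; exact: addr_gt0 fe ge.
refine (lpnorm_le fge _).
have := lp_sumD_le fe ge (lp_sum_le_powR e20 (lpspace_fin f))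
  (lp_sum_le_powR e20 (lpspace_fin g)).
exact.
Qed.

Lemma lpnormZ_le (c : R[i]) (f : lpspace p1) :
  lpnorm (c *: f) <= cmod c * lpnorm f.
Proof.
have f0 : 0 <= fine (lp_sum p f) by rewrite fine_ge0// lp_sum_ge0.
apply: lpnorm_le; first by rewrite mulr_ge0 ?cmod_ge0 ?powR_ge0.
rewrite powRM ?cmod_ge0 ?powR_ge0// -powRrM mulVf ?gt_eqF// powRr1// EFinM.
rewrite fineK; last by rewrite ge0_fin_numE ?lp_sum_ge0 ?lpspace_fin.
exact: lp_sumZ_le.
Qed.

Lemma lpnormZ (c : R[i]) (f : lpspace p1) : lpnorm (c *: f) = cmod c * lpnorm f.
Proof.
have [->|c0] := eqVneq c 0.
  rewrite Normc.normc0 mul0r; apply/eqP; rewrite eq_le powR_ge0 andbT.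
  by apply: le_trans (lpnormZ_le _ _) _; rewrite Normc.normc0 mul0r.
apply/eqP; rewrite eq_le lpnormZ_le/=.
have cp : 0 < cmod c.
  rewrite lt_neqAle cmod_ge0 andbT eq_sym; apply: contra c0 => /eqP c0.
  by apply/eqP; exact: Normc.eq0_normc.
rewrite -ler_pdivlMl// -Normc.normcV.
by rewrite -[in leLHS](scale1r f) -(mulVf c0) -scalerA lpnormZ_le.
Qed.

Lemma lpnorm_eq0 (f : lpspace p1) : lpnorm f = 0 -> f = 0.
Proof.
move=> /eqP; rewrite powR_eq0 => /andP[/eqP f0 _].
apply: val_inj; apply/funext => v /=; apply: Normc.eq0_normc.
have fE : lp_sum p f \is a fin_num by rewrite ge0_fin_numE ?lp_sum_ge0 ?lpspace_fin.
have := le_lp_sum f v; rewrite -[X in (_ <= X)%E]fineK// f0 lee_fin => fv.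
have /eqP : cmod (f v) `^ p = 0 by apply/eqP; rewrite eq_le fv powR_ge0.
by rewrite powR_eq0 => /andP[/eqP].
Qed.

(* The norm of a normed module over [R[i]] takes its values in [R[i]]. *)
Let cnorm (f : lpspace p1) : R[i] := (lpnorm f)%:C.

Let cnormD f g : cnorm (f + g) <= cnorm f + cnorm g.
Proof. by rewrite -rmorphD lecR lpnormD. Qed.

Let cnormZ c f : cnorm (c *: f) = `|c| * cnorm f.
Proof. by rewrite /cnorm lpnormZ rmorphM; case: c. Qed.

Let cnorm_eq0 f : cnorm f = 0 -> f = 0.
Proof. by case=> /lpnorm_eq0. Qed.

HB.instance Definition _ := Lmodule_isNormed.Build R[i] (lpspace p1)
  cnormD cnormZ cnorm_eq0.

Lemma lp_mul_subproof (f g : lpspace p1) : (fun v => f v * g v) \in lp_pred p1.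
Proof.
apply/lp_predP; apply: le_lt_trans (lp_sumM_le f (lpspace_fin g)) _.
rewrite -[X in (_ * X)%E]fineK ?ge0_fin_numE ?lp_sum_ge0 ?lpspace_fin//.
by rewrite -EFinM ltry.
Qed.

Definition lpmul (f g : lpspace p1) : lpspace p1 := LpSpace (lp_mul_subproof f g).

(* [f ^ m] for [m >= 1]; the algebra has no unit when [A] is infinite, and
   [lpexp f 0] is the dummy value [0]. *)
Definition lpexp (f : lpspace p1) (m : nat) : lpspace p1 := iterop m lpmul f 0.

End theory.
End LpSpace.

Section Hypercyclicity.
Variables (R : realType) (A : countType) (p : R) (p1 : 1 <= p).
Local Notation X := (lpspace A p1).
Implicit Types (B : X -> X) (S : set X).

Definition HC B : set X := [set f | dense [set iter n B f | n in [set: nat]]].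

Definition residual S := exists G : set X, [/\ Gdelta G, dense G & G `<=` S].

Definition subalgebra S :=
  [/\ S 0,
      forall f g, S f -> S g -> S (f + g),
      forall (c : R[i]) f, S f -> S (c *: f) &
      forall f g, S f -> S g -> S (lpmul f g)].

Definition hypercyclic_algebra B S :=
  [/\ subalgebra S, S <> [set 0] & S `<=` HC B `|` [set 0]].

(* [P(f)] for a polynomial [P] without constant term. *)
Definition lphorner (P : {poly R[i]}) (f : X) : X :=
  \sum_(i < size P) P`_i *: lpexp f i.

Definition generated_subalgebra (f : X) : set X :=
  [set lphorner P f | P in [set P : {poly R[i]} | P`_0 = 0]].

Definition bounded_operator B :=
  exists M : R, forall f, lpnorm (B f) <= M * lpnorm f.

(* [B] is the operator [B_lambda] on [l^p(A)]: for every [f] in [l^p(A)] and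
   every [v], the possibly infinite sum of [lambda u * f u] over the children
   [u] of [v] converges unconditionally to [B f v]. *)
Definition weighted_backward_shift (E : rel A) (lambda : A -> R[i]) B :=
  forall (f : X) (v : A),
    partial_sum (fun u => if E v u then lambda u * f u else 0) @ totally -->
      (B f v : R[i]^o).

End Hypercyclicity.

(* Main.v *)
Require Import Defs.
From HB Require Import structures.
From mathcomp Require Import all_boot all_order all_algebra.
From mathcomp Require Import all_classical all_reals all_analysis.
From mathcomp Require Import complex borel_hierarchy ring lra.
From mathcomp.analysis.showcase Require Import summability.

(** The implications (i) => (ii) => (iii) => (iv) are soft. A nonzero element of a
    dense hypercyclic algebra generates a subalgebra of it, and a dense set stays
    dense without the origin ([algebra_dense_generators]); a generator of a
    hypercyclic algebra is nonzero, so all its powers are hypercyclic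
    ([generators_hc_powers]). The set [hc_powers B] of the vectors all of whose
    powers are hypercyclic is a countable intersection of open sets, because
    [l^p(A)] is separable and [f |-> B^n(f^m)] is continuous ([hc_powersE],
    [hits_open]). It is thus residual as soon as it is dense, and by Baire's
    theorem ([countable_baire]) dense as soon as each of these open sets is.

    Write [w_n(u)] for the weight of the path of length [n] ending at [u], so that
    [B^n e_u = w_n(u) e_(par^n u)]. Condition (v) is equivalent to a statement
    about finite sets of vertices ([uniform_conditionP]): for every finite [F] and
    every [M] there is one [n] such that, for all [v] in [F], some [u] over [v],
    that is with [par^n u = v], has weight above [M] ([expanding]), and either
    [|w_n(v)| < 1/M] or some vertex with the same [n]-th ancestor as [v] has weight
    above [M |w_n(v)|] ([dominated]).

    Necessity ([dense_power_uniform_condition]). Let [f] be close to a finitely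
    supported [f0], and let [m >= p] be such that [f^m] is hypercyclic. Off the
    support of [f0] one has [|f|^m <= |f|^p], so [f^m] has tiny mass there, and
    [(B^n f^m)(y)] is controlled by this mass times the largest weight over [y]
    ([iter_shift_coord_le]). Choose a large [n] with [B^n f^m] close to [2] on [F]
    and close to [0] elsewhere. The coordinate at [v] in [F] can only be large if
    some weight over [v] is large. The coordinate at [par^n r], for [r] in the
    support of [f0], contains the term [w_n(r) f(r)^m] of modulus at least
    [|w_n(r)|]; as it is nearly cancelled, either [w_n(r)] is small or a
    comparatively large weight sits over [par^n r]. Two points of the support could
    cancel each other: therefore [f0] charges a single vertex of each class of
    vertices with a common [k]-th ancestor for some [k]. The other vertices of [F]
    inherit the conclusion, since within a class the ratios of the weights [w_n]
    do not depend on [n] once [n] is large ([representatives]).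

    Sufficiency ([hit_finite]). Given finitely supported [f] and [h] and an
    exponent [q], a small perturbation [g] of [f] with [B^n(g^q)] close to [h] is
    built by adding to [f], for each vertex [y] of [F] or [par^n(F)], one small
    multiple of a basis vector at a vertex [c] outside [F] with [par^n c = y]
    ([correction]). Over [y] in [F] it creates the value [h(y)]; over [y] in
    [par^n(F)] it cancels what [B^n] carries there from [f^q]. The required
    coefficients are [q]-th roots of quotients by large weights, hence small. The
    supports being disjoint, the power acts on each summand separately. *)

Set Implicit Arguments.
Unset Strict Implicit.
Unset Printing Implicit Defensive.

Import Order.TTheory GRing.Theory Num.Theory numFieldNormedType.Exports.

Local Open Scope classical_set_scope.
Local Open Scope ring_scope.
Local Open Scope complex_scope.

(** * Coordinates and the norm of the sequence space *)

#[local] Arguments lpfun : simpl never.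

Section LpBasics.
Variables (R : realType) (A : countType) (p : R) (p1 : 1 <= p).
Local Notation X := (lpspace A p1).
Implicit Types (f g h : X) (s : seq A).

Let p0 : 0 < p. Proof. exact: lt_le_trans p1. Qed.

Lemma lp0E v : (0 : X) v = 0. Proof. by []. Qed.

Lemma lpDE f g v : (f + g) v = f v + g v. Proof. by []. Qed.

Lemma lpBE f g v : (f - g) v = f v - g v. Proof. by []. Qed.

Lemma lpZE (c : R[i]) f v : (c *: f) v = c * f v. Proof. by []. Qed.

Lemma lpME f g v : lpmul f g v = f v * g v. Proof. by []. Qed.

Lemma lp_bigE (I : Type) (r : seq I) (F : I -> X) v :
  (\sum_(i <- r) F i) v = \sum_(i <- r) F i v.
Proof. exact: (big_morph (fun h : X => h v) (fun _ _ => erefl) erefl). Qed.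

Lemma lp_ext f g : (forall v, f v = g v) -> f = g.
Proof. by move=> fg; apply: val_inj; apply/funext. Qed.

Lemma lp_sum_le_seq (f : A -> R[i]) (c : R) :
  (forall s, uniq s -> \sum_(v <- s) cmod (f v) `^ p <= c) ->
  (lp_sum p f <= c%:E)%E.
Proof.
move=> fc; apply: ge_ereal_sup => _ [Y [finY _] <-].
by rewrite fsbig_finite//= sumEFin lee_fin; apply: fc; exact: finmap.fset_uniq.
Qed.

Lemma ge_lp_sum_seq (f : A -> R[i]) s : uniq s ->
  ((\sum_(v <- s) cmod (f v) `^ p)%:E <= lp_sum p f)%E.
Proof.
move=> us; apply: esum_ge; exists [set` s]; first by split => //; exact: finite_seq.
by rewrite -fsbig_seq// sumEFin.
Qed.

Lemma lpnorm_ge0 f : 0 <= lpnorm f. Proof. exact: powR_ge0. Qed.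

Lemma lpnorm_powR f : (lpnorm f `^ p)%:E = lp_sum p f.
Proof.
have fE : lp_sum p f \is a fin_num by rewrite ge0_fin_numE ?lp_sum_ge0 ?lpspace_fin.
by rewrite /lpnorm -powRrM mulVf ?gt_eqF// powRr1 ?fineK// fine_ge0// lp_sum_ge0.
Qed.

Lemma ge_lpnorm_seq f s : uniq s ->
  \sum_(v <- s) cmod (f v) `^ p <= lpnorm f `^ p.
Proof. by move=> us; rewrite -lee_fin lpnorm_powR ge_lp_sum_seq. Qed.

Lemma lpnorm_le_seq f a : 0 <= a ->
  (forall s, uniq s -> \sum_(v <- s) cmod (f v) `^ p <= a `^ p) -> lpnorm f <= a.
Proof. by move=> a0 fa; apply: (lpnorm_le a0); exact: lp_sum_le_seq. Qed.

Lemma cmod_le_lpnorm f v : cmod (f v) <= lpnorm f.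
Proof.
have := @ge_lpnorm_seq f [:: v] isT; rewrite big_seq1 => fv.
rewrite leNgt; apply/negP => /(gt0_ltr_powR p0).
by rewrite !nnegrE lpnorm_ge0 cmod_ge0 ltNge fv => /(_ isT isT).
Qed.

Lemma lpnorm0 : lpnorm (0 : X) = 0.
Proof.
by apply/eqP; rewrite -(scale0r (0 : X)) lpnormZ Normc.normc0 mul0r.
Qed.

Lemma lpnormN f : lpnorm (- f) = lpnorm f.
Proof. by rewrite -scaleN1r lpnormZ normcN Normc.normc1 mul1r. Qed.

Lemma lpnorm_distC f g : lpnorm (f - g) = lpnorm (g - f).
Proof. by rewrite -lpnormN opprB. Qed.

Lemma lpnorm_dist3 g f h : lpnorm (f - h) <= lpnorm (f - g) + lpnorm (g - h).
Proof. by rewrite -[f - h](subrKA g); exact: lpnormD. Qed.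

Lemma lpnorm_le_dist f g : lpnorm g <= lpnorm (g - f) + lpnorm f.
Proof. by rewrite -{1}[g](subrK f); exact: lpnormD. Qed.

Lemma lpnorm_sum (I : Type) (r : seq I) (F : I -> X) :
  lpnorm (\sum_(i <- r) F i) <= \sum_(i <- r) lpnorm (F i).
Proof.
elim/big_rec2: _ => [|i x f _ fx]; first by rewrite lpnorm0.
by apply: le_trans (lpnormD _ _) _; rewrite lerD2l.
Qed.

Lemma lpnormM f g : lpnorm (lpmul f g) <= lpnorm f * lpnorm g.
Proof.
apply: lpnorm_le; first by rewrite mulr_ge0 ?lpnorm_ge0.
apply: le_trans (lp_sumM_le f (lpspace_fin g)) _.
rewrite -(lpnorm_powR f) -(lpnorm_powR g) -EFinM lee_fin.
move: (lpnorm_ge0 f) (lpnorm_ge0 g) => /[swap].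
generalize (lpnorm f) (lpnorm g) => a b b0 a0 /=.
by rewrite powRM// mulrC.
Qed.

End LpBasics.

#[local] Opaque lpnorm.

Section PowersAndSupports.
Variables (R : realType) (A : countType) (p : R) (p1 : 1 <= p).
Local Notation X := (lpspace A p1).
Implicit Types (f g h : X) (s : seq A).

Let p0 : 0 < p. Proof. exact: lt_le_trans p1. Qed.

Lemma lpexpE f m v : (0 < m)%N -> lpexp f m v = f v ^+ m.
Proof.
case: m => // m _; rewrite /lpexp iteropS.
by elim: m => [|m IH]; rewrite ?expr1// iterS exprS -IH.
Qed.

Lemma lpexpS f m : lpexp f m.+2 = lpmul f (lpexp f m.+1).
Proof. by rewrite /lpexp !iteropS. Qed.

(** * Finitely supported vectors *)

Lemma lpdelta_le1 (a : A) : (lp_sum p (fun v => (v == a)%:R : R[i]) <= 1%:E)%E.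
Proof.
apply: lp_sum_le_seq => s us.
rewrite (eq_bigr (fun v => (v == a)%:R : R)); last first.
  by move=> v _; case: eqP; rewrite ?Normc.normc1 ?Normc.normc0 ?powR1 ?powR0 ?gt_eqF.
rewrite -natr_sum -[leRHS]/(1%:R) ler_nat.
rewrite (eq_bigr (fun v => if v == a then 1 else 0)%N); last by move=> v _; case: eqP.
by rewrite -big_mkcond sum1_count (count_uniq_mem a us) leq_b1.
Qed.

Lemma lpdelta_subproof (a : A) : (fun v => (v == a)%:R : R[i]) \in lp_pred p1.
Proof. by apply/lp_predP; exact: le_lt_trans (lpdelta_le1 a) (ltry _). Qed.

Definition lpdelta (a : A) : X := LpSpace (lpdelta_subproof a).

Lemma lpdeltaE a v : lpdelta a v = (v == a)%:R. Proof. by []. Qed.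

Lemma lpnorm_delta a : lpnorm (lpdelta a) <= 1.
Proof. by apply: lpnorm_le => //; rewrite powR1; exact: lpdelta_le1. Qed.

Definition lpfin s (c : A -> R[i]) : X := \sum_(a <- undup s) c a *: lpdelta a.

Lemma lpfinE s c v : lpfin s c v = if v \in s then c v else 0.
Proof.
rewrite /lpfin lp_bigE (eq_bigr (fun a => if a == v then c v else 0)); last first.
  by move=> a _; rewrite lpZE lpdeltaE eq_sym; case: eqP => [->|]; rewrite ?mulr1 ?mulr0.
rewrite -big_mkcond/= big_const_seq.
rewrite (count_uniq_mem v (undup_uniq s)) mem_undup.
by case: (v \in s); rewrite //= addr0.
Qed.

Lemma lpnorm_fin_le s c (d : R) : (forall a, a \in s -> cmod (c a) <= d) ->
  lpnorm (lpfin s c) <= (size s)%:R * d.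
Proof.
case: s => [|a s] cd; first by rewrite /lpfin big_nil lpnorm0 mul0r.
have d0 : 0 <= d by apply: le_trans (cd a _); rewrite ?cmod_ge0 ?mem_head.
rewrite /lpfin; set r := a :: s in cd *; apply: le_trans (lpnorm_sum _ _) _.
apply: (@le_trans _ _ (\sum_(a <- undup r) d)).
  rewrite big_seq [leRHS]big_seq; apply: ler_sum => b; rewrite mem_undup => br.
  rewrite lpnormZ -[leRHS]mulr1.
  by apply: ler_pM; rewrite ?cmod_ge0 ?lpnorm_ge0 ?lpnorm_delta ?cd.
rewrite big_const_seq count_predT iter_addr_0 -[leLHS]mulr_natl.
by rewrite ler_wpM2r// ler_nat size_undup.
Qed.

Lemma lpnorm_trunc_le s f : lpnorm (lpfin s f) <= lpnorm f.
Proof.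
apply: lpnorm_le_seq; first exact: lpnorm_ge0.
move=> t ut; apply: le_trans (ge_lpnorm_seq f ut); apply: ler_sum => v _.
rewrite lpfinE; case: ifP => // _.
by rewrite Normc.normc0 powR0 ?powR_ge0 ?gt_eqF.
Qed.

(** A bound on all finite truncations is how a coordinatewise limit is shown to lie
    in the space. *)
Lemma lp_trunc_le (f : A -> R[i]) (a : R) : 0 <= a ->
  (forall s, lpnorm (lpfin s f) <= a) -> (lp_sum p f <= (a `^ p)%:E)%E.
Proof.
move=> a0 fa; apply: lp_sum_le_seq => s us.
rewrite big_seq (eq_bigr (fun v => cmod (lpfin s f v) `^ p)); last first.
  by move=> v vs; rewrite lpfinE vs.
rewrite -big_seq; apply: le_trans (ge_lpnorm_seq _ us) _.
by apply: ge0_ler_powR; rewrite ?nnegrE ?lpnorm_ge0// ltW.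
Qed.

Lemma lp_trunc_approx f (e : R) : 0 < e ->
  exists s, lpnorm (f - lpfin s f) <= e.
Proof.
move=> e0; have ep : 0 < e `^ p by exact: powR_gt0.
have : ((lpnorm f `^ p - e `^ p)%:E < lp_sum p f)%E.
  by rewrite -lpnorm_powR lte_fin ltrBlDr ltrDl.
move=> /ereal_sup_gt[_ [Y [finY _] <-]]; rewrite fsbig_finite//= sumEFin lte_fin.
set s := (X in \sum_(_ <- X) _) => fs.
exists s; apply: lpnorm_le_seq => [|t ut]; first exact: ltW.
have us : uniq s by exact: finmap.fset_uniq.
have : \sum_(v <- s ++ [seq v <- t | v \notin s]) cmod (f v) `^ p <= lpnorm f `^ p.
  apply: ge_lpnorm_seq; rewrite cat_uniq us filter_uniq// andbT/=.
  by apply/hasPn => v; rewrite mem_filter => /andP[].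
rewrite big_cat/= big_filter => fst.
rewrite (eq_bigr (fun v => if v \notin s then cmod (f v) `^ p else 0)).
  by rewrite -big_mkcond; move: fs fst; lra.
move=> v _; rewrite lpBE lpfinE; case: ifP => _ /=; last by rewrite subr0.
by rewrite subrr Normc.normc0 powR0// gt_eqF.
Qed.

(** * The topology through the real-valued norm *)

Lemma open_lpnorm (U : set X) :
  open U <-> forall f, U f -> exists2 e : R, 0 < e & forall g, lpnorm (g - f) < e -> U g.
Proof.
rewrite openE; split=> [oU f /oU|H f Uf].
  rewrite /interior/= => /nbhs_normP[e/= e0 eU].
  have eR : e = (complex.Re e)%:C by rewrite RRe_real// gtr0_real.
  exists (complex.Re e) => [|g gf]; first by rewrite -ltcR -eR.
  apply: eU => /=; rewrite /= distrC eR.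
  by rewrite -[`|_|]/((lpnorm _)%:C) ltcR.
have [e e0 eU] := H f Uf.
apply/nbhs_normP; exists e%:C; first by rewrite /= ltcR.
by move=> g/=; rewrite distrC -[`|_|]/((lpnorm _)%:C) ltcR; exact: eU.
Qed.

Lemma dense_lpnorm (D : set X) :
  dense D <-> forall f e, 0 < e -> exists2 g, D g & lpnorm (g - f) < e.
Proof.
split=> [dD f e e0|H U [f Uf] /open_lpnorm/(_ f Uf)[e e0 eU]]; last first.
  by have [g Dg gf] := H f e e0; exists g; split => //; exact: eU.
have [||g [gU Dg]] := dD [set g | lpnorm (g - f) < e].
- by exists f => /=; rewrite subrr lpnorm0.
- apply/open_lpnorm => g/= gf; exists (e - lpnorm (g - f)).
    by rewrite subr_gt0.
  move=> h hg; apply: le_lt_trans (lpnorm_dist3 g _ _) _.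
  by rewrite -ltrBrDr.
- by exists g.
Qed.

(** By induction on the exponent, from
    [g^(m+1) - f^(m+1) = g (g^m - f^m) + (g - f) f^m]. *)
Lemma lpexp_continuous f m e : 0 < e ->
  exists2 d, 0 < d & forall g, lpnorm (g - f) < d -> lpnorm (lpexp g m.+1 - lpexp f m.+1) < e.
Proof.
elim: m e => [|m IH] e e0; first by exists e.
have [K K0 fK] : exists2 K, 0 < K & lpnorm f + 1 <= K.
  by exists (lpnorm f + 1); rewrite // ltr_wpDl// lpnorm_ge0.
have [L L0 fL] : exists2 L, 0 < L & lpnorm (lpexp f m.+1) <= L.
  exists (lpnorm (lpexp f m.+1) + 1); first by rewrite ltr_wpDl// lpnorm_ge0.
  by rewrite lerDl.
have [|d d0 fd] := IH (e / (2 * K)); first by rewrite divr_gt0// mulr_gt0.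
have [d' d'0 d'P] : exists2 d' : R, 0 < d' &
    forall x, x < d' -> [/\ x < d, x < 1 & x < e / (2 * L)].
  exists (Num.min (Num.min d 1) (e / (2 * L))).
    by rewrite !lt_min d0 ltr01/= divr_gt0// mulr_gt0.
  by move=> x; rewrite !lt_min => /andP[/andP[]].
exists d' => // g /d'P[gd g1 gL].
rewrite !lpexpS.
have -> : lpmul g (lpexp g m.+1) - lpmul f (lpexp f m.+1) =
    lpmul g (lpexp g m.+1 - lpexp f m.+1) + lpmul (g - f) (lpexp f m.+1).
  by apply: lp_ext => v; rewrite !(lpBE, lpDE, lpME); ring.
apply: le_lt_trans (lpnormD _ _) _; rewrite (splitr e); apply: ltrD.
  apply: le_lt_trans (lpnormM _ _) _.
  have gK : lpnorm g <= K.
    apply: le_trans fK; apply: le_trans (lpnorm_le_dist f g) _.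
    by rewrite [leRHS]addrC; exact: lerD (ltW g1) (lexx _).
  apply: (@le_lt_trans _ _ (K * lpnorm (lpexp g m.+1 - lpexp f m.+1))).
    by rewrite ler_wpM2r ?lpnorm_ge0.
  by rewrite -ltr_pdivlMl//; apply: lt_le_trans (fd _ gd) _; rewrite invfM mulrA mulrC.
apply: le_lt_trans (lpnormM _ _) _.
apply: (@le_lt_trans _ _ (lpnorm (g - f) * L)).
  by rewrite ler_wpM2l ?lpnorm_ge0.
by rewrite -ltr_pdivlMr//; apply: lt_le_trans gL _; rewrite invfM mulrA.
Qed.

End PowersAndSupports.

(** * Nested balls and the Baire property *)

Section RealNested.
Variable R : realType.

(** The intervals [[a k - r k, a k + r k]] are nested, so that the supremum of their
    left ends belongs to all of them. *)
Lemma nested_real (a r : nat -> R) :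
  (forall k, 0 <= r k) -> (forall k, `|a k.+1 - a k| + r k.+1 <= r k) ->
  exists L, forall k, `|L - a k| <= r k.
Proof.
move=> r0 ar.
have ar_add j i : `|a (j + i)%N - a j| + r (j + i)%N <= r j.
  elim: i => [|i IH]; first by rewrite addn0 subrr normr0 add0r.
  apply: le_trans IH; have := ar (j + i)%N; rewrite addnS => H.
  apply: le_trans (lerD (ler_distD (a (j + i)%N) _ _) (lexx _)) _.
  by rewrite addrAC addrC lerD2l.
have lohi j k : a j - r j <= a k + r k.
  have [jk|/ltnW kj] := leqP j k.
    have := ar_add j (k - j)%N; rewrite subnKC// => H.
    have := ler_norm (a j - a k); rewrite distrC; have := r0 k; lra.
  have := ar_add k (j - k)%N; rewrite subnKC// => H.
  have := ler_norm (a j - a k); have := r0 j; lra.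
exists (sup (range (fun k => a k - r k))) => k.
have lo : a k - r k <= sup (range (fun k => a k - r k)).
  apply: ub_le_sup; last by exists k.
  by exists (a 0%N + r 0%N) => _ [j _ <-].
have hi : sup (range (fun k => a k - r k)) <= a k + r k.
  apply: ge_sup; first by exists (a 0%N - r 0%N), 0%N.
  by move=> _ [j _ <-].
by rewrite ler_norml; apply/andP; split; lra.
Qed.

Lemma normr_Re_le (z : R[i]) : `|complex.Re z| <= cmod z.
Proof. by rewrite -lecR; apply: le_trans (normc_ge_Re z) _; case: z. Qed.

Lemma normr_Im_le (z : R[i]) : `|complex.Im z| <= cmod z.
Proof.
case: z => a b /=; rewrite -[leLHS]sqrtr_sqr.
by rewrite ler_wsqrtr// lerDr sqr_ge0.
Qed.

Lemma cmod_le_ReIm (a b : R) : cmod (a +i* b) <= `|a| + `|b|.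
Proof.
rewrite /= -[leRHS]ger0_norm ?addr_ge0// -sqrtr_sqr ler_wsqrtr//.
rewrite sqrrD !real_normK ?num_real// addrAC lerDl mulrn_wge0// mulr_ge0//.
Qed.

Lemma cmod_sum_le (I : Type) (r : seq I) (F : I -> R[i]) :
  cmod (\sum_(i <- r) F i) <= \sum_(i <- r) cmod (F i).
Proof.
elim/big_rec2: _ => [|i x z _ xz]; first by rewrite Normc.normc0.
by apply: le_trans (le_normcD _ _) _; rewrite lerD2l.
Qed.

Lemma cmodX (z : R[i]) n : cmod (z ^+ n) = cmod z ^+ n.
Proof.
by elim: n => [|n IH]; rewrite ?expr0 ?Normc.normc1// !exprS Normc.normcM IH.
Qed.

Lemma cmod_nat n : cmod (n%:R : R[i]) = n%:R.
Proof. by rewrite normcMn Normc.normc1. Qed.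

Lemma small_root (z : R[i]) (d : R) q : (0 < q)%N -> 0 <= d -> cmod z <= d ^+ q ->
  exists2 b : R[i], b ^+ q = z & cmod b <= d.
Proof.
move=> q0 d0 zd; exists (q.-root z); first exact: rootCK.
have /(congr1 cmod) := rootCK q0 z; rewrite /= cmodX => bz.
by rewrite -(ler_pXn2r q0) ?nnegrE ?cmod_ge0// bz.
Qed.

(** The radius doubles because the limit is taken separately in the real and the
    imaginary part. *)
Lemma nested_complex (a : nat -> R[i]) (r : nat -> R) :
  (forall k, 0 <= r k) -> (forall k, cmod (a k.+1 - a k) + r k.+1 <= r k) ->
  exists L, forall k, cmod (L - a k) <= r k + r k.
Proof.
move=> r0 ar.
have [|x xP] := @nested_real (fun k => complex.Re (a k)) r r0.
  move=> k; apply: le_trans (ar k); rewrite lerD2r.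
  by apply: le_trans (normr_Re_le _); case: (a k) (a k.+1) => ? ? [].
have [|y yP] := @nested_real (fun k => complex.Im (a k)) r r0.
  move=> k; apply: le_trans (ar k); rewrite lerD2r.
  by apply: le_trans (normr_Im_le _); case: (a k) (a k.+1) => ? ? [].
exists (x +i* y) => k; move: (xP k) (yP k); case: (a k) => u v /= xu yv.
exact: le_trans (cmod_le_ReIm (x - u) (y - v)) (lerD xu yv).
Qed.

End RealNested.

Section Baire.
Variables (R : realType) (A : countType) (p : R) (p1 : 1 <= p).
Local Notation X := (lpspace A p1).

(** Completeness in the form used below. The limit is taken coordinate by
    coordinate; its finite truncations satisfy the bound because, on a finite set,
    coordinatewise convergence is convergence in norm. *)
Lemma nested_balls (g : nat -> X) (r : nat -> R) :
  (forall k, 0 <= r k) -> (forall e, 0 < e -> exists k, r k < e) ->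
  (forall k, lpnorm (g k.+1 - g k) + r k.+1 <= r k) ->
  exists G : X, forall k, lpnorm (G - g k) <= r k.
Proof.
move=> r0 r_small gr.
have [L LP] : exists L : A -> R[i], forall v k, cmod (L v - g k v) <= r k + r k.
  have H v : exists z : R[i], forall k, cmod (z - g k v) <= r k + r k.
    apply: nested_complex => // k; apply: le_trans (gr k); rewrite lerD2r.
    by rewrite -lpBE; exact: cmod_le_lpnorm.
  by have [L LP] := choice H; exists L.
have gr_add j i : lpnorm (g (j + i)%N - g j) + r (j + i)%N <= r j.
  elim: i => [|i IH]; first by rewrite addn0 subrr lpnorm0 add0r.
  apply: le_trans IH; have := gr (j + i)%N; rewrite addnS => H.
  apply: le_trans (lerD (lpnorm_dist3 (g (j + i)%N) _ _) (lexx _)) _.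
  by rewrite addrAC addrC lerD2l.
have trunc k s : lpnorm (lpfin p1 s (fun v => L v - g k v)) <= r k.
  apply/ler_addgt0Pr => e e0.
  (* On [s], the distance from [L] to [g j] is at most [size s * 2 r j <= e]. *)
  have [|j0 rj0] := r_small (e / (2 * (size s).+1%:R)).
    by rewrite divr_gt0 ?mulr_gt0 ?ltr0n.
  pose j := (k + j0)%N.
  have rj : r j <= r j0.
    rewrite /j addnC; apply: le_trans (gr_add j0 k); rewrite lerDr; exact: lpnorm_ge0.
  have -> : lpfin p1 s (fun v => L v - g k v) =
      lpfin p1 s (fun v => L v - g j v) + lpfin p1 s (g j - g k).
    apply: lp_ext => v; rewrite lpDE !lpfinE; case: ifP => _; last by rewrite addr0.
    by rewrite lpBE subrKA.
  apply: le_trans (lpnormD _ _) _; rewrite addrC; apply: lerD.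
    apply: le_trans (lpnorm_trunc_le _ _) _; apply: le_trans (gr_add k j0).
    by rewrite lerDl.
  apply: le_trans (lpnorm_fin_le p1 (d := r j + r j) _) _ => [a _|]; first exact: LP.
  move: rj0; rewrite ltr_pdivlMr ?mulr_gt0 ?ltr0n// => /ltW; apply: le_trans.
  rewrite [leLHS](_ : _ = r j * (2 * (size s)%:R)); last by ring.
  apply: ler_pM => //.
  by rewrite ler_wpM2l ?ler0n// ler_nat.
have [D DE] : exists D : X, forall v, D v = L v - g 0%N v.
  have Dlp : (fun v => L v - g 0%N v) \in lp_pred p1.
    apply/lp_predP; apply: le_lt_trans (ltry (r 0%N `^ p)).
    by apply: (lp_trunc_le (p1 := p1)) => // s; exact: trunc.
  by exists (LpSpace Dlp).
exists (D + g 0%N) => k; apply: lpnorm_le => //; apply: (lp_trunc_le (p1 := p1)) => // s.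
have -> : lpfin p1 s (D + g 0%N - g k) = lpfin p1 s (fun v => L v - g k v).
  by apply: lp_ext => v; rewrite !lpfinE lpBE lpDE DE subrK.
exact: trunc.
Qed.

(** Baire's theorem: nested closed balls, the [k]-th one inside [U k]. *)
Lemma lp_baire (U : nat -> set X) :
  (forall k, open (U k)) -> (forall k, dense (U k)) -> dense (\bigcap_k U k).
Proof.
move=> oU dU; apply/dense_lpnorm => f e e0.
pose good k (x y : X * R) := [/\ 0 < y.2, y.2 <= x.2 / 2,
  lpnorm (y.1 - x.1) + y.2 <= x.2 & forall h, lpnorm (h - y.1) <= y.2 -> U k h].
have step (kx : nat * (X * R)) : exists y, 0 < kx.2.2 -> good kx.1 kx.2 y.
  case: kx => k [g r] /=; have [r0|_] := ltP 0 r; last by exists (g, r).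
  have r20 : 0 < r / 2 by rewrite divr_gt0.
  have /dense_lpnorm/(_ g (r / 2) r20)[g' Ug' g'g] := dU k.
  have /open_lpnorm/(_ g' Ug')[d d0 dU'] := oU k.
  exists (g', Num.min (r / 2) (d / 2)) => _; split=> /=.
  - by rewrite lt_min r20/= divr_gt0.
  - by rewrite ge_min lexx.
  - rewrite [leRHS]splitr; apply: lerD; first exact: ltW.
    by rewrite ge_min lexx.
  - move=> h hg'; apply: dU'; apply: le_lt_trans hg' _.
    by rewrite gt_min; apply/orP; right; rewrite ltr_pdivrMr// mulr_natr mulr2n ltrDl.
have [nxt nxtP] := choice step.
pose x := fix x k := if k is j.+1 then nxt (j, x j) else (f, e / 2).
have x0 k : 0 < (x k).2.
  elim: k => [|k IH] /=; first by rewrite divr_gt0.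
  by have [] := nxtP (k, x k) IH.
have xP k : good k (x k) (x k.+1) by exact: nxtP (k, x k) (x0 k).
have small d : 0 < d -> exists k, (x k).2 < d.
  move=> d0; have xk k : (x k).2 <= e / 2 / 2 ^+ k.
    elim: k => [|k IH]; first by rewrite expr0 divr1.
    have [_ H _ _] := xP k; apply: le_trans H _.
    by rewrite exprSr invfM mulrA ler_wpM2r.
  have [k kP] : exists k, e / 2 / d < 2 ^+ k.
    exists (Num.bound (e / 2 / d)).
    have := archi_boundP (ltW (divr_gt0 (divr_gt0 e0 (ltr0n R 2)) d0)).
    move=> /lt_le_trans; apply; rewrite -natrX ler_nat; apply: ltnW; exact: ltn_expl.
  exists k; apply: le_lt_trans (xk k) _.
  by rewrite ltr_pdivrMr ?exprn_gt0// [ltRHS]mulrC -ltr_pdivrMr.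
have [||G GP] := @nested_balls (fun k => (x k).1) (fun k => (x k).2) _ small.
- by move=> k; exact: ltW.
- by move=> k; have [] := xP k.
exists G.
  by move=> k _; have [_ _ _] := xP k; apply; exact: GP.
by apply: le_lt_trans (GP 0%N) _; rewrite /= ltr_pdivrMr// mulr_natr mulr2n ltrDl.
Qed.

Lemma countable_Gdelta (J : countType) (O : J -> set X) :
  (forall i, open (O i)) -> Gdelta (\bigcap_i O i).
Proof.
move=> oO; exists (fun n => if unpickle n is Some i then O i else setT).
  by move=> n; case: unpickle => // ; exact: openT.
apply/seteqP; split=> f fO.
  by move=> n _; case: unpickle => // i; exact: fO.
by move=> i _; have := fO (pickle i) I; rewrite pickleK.
Qed.

Lemma countable_baire (J : countType) (O : J -> set X) :
  (forall i, open (O i)) -> (forall i, dense (O i)) -> dense (\bigcap_i O i).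
Proof.
move=> oO dO.
have -> : \bigcap_i O i = \bigcap_n (if unpickle n is Some i then O i else setT).
  apply/seteqP; split=> f fO.
    by move=> n _; case: unpickle => // i; exact: fO.
  by move=> i _; have := fO (pickle i) I; rewrite pickleK.
apply: lp_baire => n; case: unpickle => //; first exact: openT.
by move=> U U0 _; rewrite setIT.
Qed.

End Baire.

(** * Orbits and hypercyclic powers *)

Section Hypercyclic.
Variables (R : realType) (A : countType) (p : R) (p1 : 1 <= p).
Local Notation X := (lpspace A p1).

Lemma rat_approx (x e : R) : 0 < e -> exists q : rat, `|x - ratr q| < e.
Proof.
move=> e0; have [|q] := @rat_in_itvoo R (x - e) (x + e); first by lra.
rewrite in_itv/= => /andP[q1 q2]; exists q.
by rewrite ltr_norml; apply/andP; split; lra.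
Qed.

(** These vectors form a countable dense set. *)
Definition rat_comb (t : seq (A * (rat * rat))) : X :=
  \sum_(x <- t) (ratr x.2.1 +i* ratr x.2.2) *: lpdelta p1 x.1.

Lemma rat_comb_sum_approx s (c : A -> R[i]) e : 0 < e ->
  exists t, lpnorm (rat_comb t - \sum_(a <- s) c a *: lpdelta p1 a) < e.
Proof.
elim: s e => [|a s IH] e e0.
  by exists [::]; rewrite /rat_comb !big_nil subrr lpnorm0.
have [|t tP] := IH (e / 2); first by rewrite divr_gt0.
have [q qP] : exists q : rat * rat, cmod ((ratr q.1 +i* ratr q.2) - c a) < e / 2.
  have e4 : 0 < e / 4 by rewrite divr_gt0.
  case: (c a) => x y.
  have [q1 q1P] := rat_approx x e4; have [q2 q2P] := rat_approx y e4.
  exists (q1, q2); apply: le_lt_trans (cmod_le_ReIm (ratr q1 - x) (ratr q2 - y)) _.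
  by move: q1P q2P; rewrite (distrC x) (distrC y); lra.
exists ((a, q) :: t); rewrite /rat_comb !big_cons opprD addrACA -scalerBl.
apply: le_lt_trans (lpnormD _ _) _; rewrite (splitr e); apply: ltrD; last exact: tP.
rewrite lpnormZ; apply: le_lt_trans qP.
rewrite -[leRHS]mulr1; apply: ler_pM; rewrite ?cmod_ge0 ?lpnorm_ge0//.
exact: lpnorm_delta.
Qed.

Lemma lp_fin_dense (f : X) e : 0 < e -> exists s, lpnorm (lpfin p1 s f - f) < e.
Proof.
move=> e0; have [|s sP] := @lp_trunc_approx _ _ _ p1 f (e / 2); first by rewrite divr_gt0.
exists s; rewrite lpnorm_distC; apply: le_lt_trans sP _.
by rewrite ltr_pdivrMr// mulr_natr mulr2n ltrDl.
Qed.

Lemma rat_comb_dense (f : X) e : 0 < e -> exists t, lpnorm (rat_comb t - f) < e.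
Proof.
move=> e0; have e2 : 0 < e / 2 by rewrite divr_gt0.
have [s sP] := lp_fin_dense f e2.
have [t tP] := rat_comb_sum_approx (undup s) f e2.
exists t; apply: le_lt_trans (lpnorm_dist3 (lpfin p1 s f) _ _) _.
by rewrite (splitr e); exact: ltrD tP sP.
Qed.

(** A nonzero space has no isolated point, so every ball contains a smaller one that
    misses a given vector. *)
Lemma dense_avoid (D : set X) (z : X) (bad : nat -> X) N : dense D -> z <> 0 ->
  forall f e, 0 < e -> exists g,
    [/\ D g, lpnorm (g - f) < e & forall i, (i < N)%N -> g <> bad i].
Proof.
move=> /dense_lpnorm dD z0; elim: N => [|N IH] f e e0.
  by have [g Dg gf] := dD f e e0; exists g; split.
have lz : 0 < lpnorm z.
  by rewrite lt_neqAle lpnorm_ge0 andbT eq_sym; apply/eqP => /lpnorm_eq0.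
have e2 : 0 < e / 2 by rewrite divr_gt0.
have [f' [f'f f'b]] : exists f' : X, lpnorm (f' - f) <= e / 2 /\ f' <> bad N.
  have [<-|fb] := pselect (f = bad N); last first.
    by exists f; rewrite subrr lpnorm0; split => //; exact: ltW.
  pose c : R := e / 2 / lpnorm z.
  have c0 : 0 < c by rewrite divr_gt0.
  exists (f + c%:C *: z); rewrite addrAC subrr add0r lpnormZ; split.
    by rewrite /= expr0n/= addr0 sqrtr_sqr gtr0_norm// /c divfK// gt_eqF.
  rewrite -[X in _ <> X]addr0 => /addrI/eqP; rewrite scaler_eq0 => /orP[|/eqP//].
  by rewrite eq_complex /= eqxx andbT gt_eqF.
have lb : 0 < lpnorm (bad N - f').
  rewrite lt_neqAle lpnorm_ge0 andbT eq_sym; apply/eqP => /lpnorm_eq0/eqP.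
  by rewrite subr_eq0 => /eqP/esym.
have [|g [Dg gf' gb]] := IH f' (Num.min (e / 2) (lpnorm (bad N - f'))).
  by rewrite lt_min e2.
have [ge gN] : lpnorm (g - f') < e / 2 /\ lpnorm (g - f') < lpnorm (bad N - f').
  by move: gf'; rewrite lt_min => /andP.
exists g; split=> //.
  apply: le_lt_trans (lpnorm_dist3 f' _ _) _.
  by rewrite (splitr e); exact: ltr_leD ge f'f.
move=> i; rewrite ltnS leq_eqVlt => /orP[/eqP -> gE|]; last exact: gb.
by move: gN; rewrite gE ltxx.
Qed.

(** The first [N] points of a dense orbit can be dispensed with, so the time at which
    it visits a ball can be taken as large as wanted. *)
Lemma dense_orbit_late (B : X -> X) (g z : X) : HC B g -> z <> 0 ->
  forall N f e, 0 < e -> exists2 n, (N <= n)%N & lpnorm (iter n B g - f) < e.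
Proof.
move=> hc z0 N f e e0.
have [h [[n _ <-] hf hb]] := dense_avoid (fun i => iter i B g) N hc z0 f e0.
by exists n => //; rewrite leqNgt; apply/negP => /hb.
Qed.

Section Lipschitz.
Variables (B : X -> X) (K : R).
Hypothesis K0 : 0 < K.
Hypothesis B_lip : forall f g, lpnorm (B f - B g) <= K * lpnorm (f - g).

Lemma iter_lip n f g : lpnorm (iter n B f - iter n B g) <= K ^+ n * lpnorm (f - g).
Proof.
elim: n => [|n IH]; first by rewrite mul1r.
rewrite !iterS; apply: le_trans (B_lip _ _) _.
by rewrite exprS -mulrA ler_wpM2l// ltW.
Qed.

Definition hits m h d : set X :=
  [set f | exists n, lpnorm (iter n B (lpexp f m.+1) - h) < d].

Lemma hits_open m h d : open (hits m h d).
Proof.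
apply/open_lpnorm => f [n fn].
pose e := d - lpnorm (iter n B (lpexp f m.+1) - h).
have e0 : 0 < e by rewrite subr_gt0.
have Kn : 0 < K ^+ n by rewrite exprn_gt0.
have [|c c0 cP] := @lpexp_continuous _ _ _ p1 f m (e / K ^+ n); first by rewrite divr_gt0.
exists c => // g /cP; rewrite ltr_pdivlMr// mulrC => gf.
exists n; apply: le_lt_trans (lpnorm_dist3 (iter n B (lpexp f m.+1)) _ _) _.
by rewrite -ltrBrDr; apply: le_lt_trans (iter_lip _ _ _) _.
Qed.

Definition hc_powers : set X :=
  [set f | forall m : nat, (1 <= m)%N -> HC B (lpexp f m)].

Lemma hc_powersE : hc_powers =
  \bigcap_(i : nat * seq (A * (rat * rat)) * nat)
    hits i.1.1 (rat_comb i.1.2) i.2.+1%:R^-1.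
Proof.
apply/seteqP; split=> f fP.
  move=> [[m t] j] _ /=; have /dense_lpnorm := fP m.+1 isT.
  move=> /(_ (rat_comb t) j.+1%:R^-1); rewrite invr_gt0 ltr0n => /(_ isT)[g [n _ <-] gt].
  by exists n.
case=> // m _; apply/dense_lpnorm => h e e0.
pose j := Num.bound (2 / e).
have je : j.+1%:R^-1 < e / 2.
  rewrite -[e / 2]invrK ltf_pV2 ?posrE ?invr_gt0 ?divr_gt0 ?ltr0n//.
  rewrite invfM invrK mulrC.
  have /lt_le_trans := archi_boundP (ltW (divr_gt0 (ltr0n R 2) e0)).
  by apply; rewrite ler_nat.
have [|t tP] := @rat_comb_dense h (e / 2); first by rewrite divr_gt0.
have [n /= nP] := fP (m, t, j) I.
exists (iter n B (lpexp f m.+1)); first by exists n.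
apply: le_lt_trans (lpnorm_dist3 (rat_comb t) _ _) _.
by rewrite (splitr e); exact: ltrD (lt_trans nP je) tP.
Qed.

Lemma hc_powers_Gdelta : Gdelta hc_powers.
Proof. by rewrite hc_powersE; apply: countable_Gdelta => i; exact: hits_open. Qed.

Lemma hc_powers_dense : (forall m h d, 0 < d -> dense (hits m h d)) -> dense hc_powers.
Proof.
move=> H; rewrite hc_powersE; apply: countable_baire => i; first exact: hits_open.
by apply: H; rewrite invr_gt0 ltr0n.
Qed.

Lemma hc_powers_residual : dense hc_powers -> residual hc_powers.
Proof. by move=> d; exists hc_powers; split => //; exact: hc_powers_Gdelta. Qed.

End Lipschitz.

(** * Subalgebras generated by one vector *)

Section Algebras.
Variable B : X -> X.

(** Makes identities in the generated subalgebra follow from identities between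
    polynomials. As [lpexp f 0] is [0], a nonzero constant term would be lost. *)
Lemma lphornerE (P : {poly R[i]}) (f : X) v : P`_0 = 0 -> lphorner P f v = P.[f v].
Proof.
move=> P0; rewrite /lphorner lp_bigE horner_coef; apply: eq_bigr => i _; rewrite lpZE.
by case: (nat_of_ord i) => [|j]; [rewrite P0 !mul0r|rewrite lpexpE].
Qed.

Lemma lphornerXn (f : X) m : (0 < m)%N -> lphorner ('X^m : {poly R[i]}) f = lpexp f m.
Proof.
move=> m0; apply: lp_ext => v; rewrite lphornerE ?coefXn; last by case: m m0.
by rewrite hornerXn lpexpE.
Qed.

Lemma generated_subalgebraP (f : X) : subalgebra (generated_subalgebra f).
Proof.
split.
- by exists 0; rewrite /= ?coef0//; apply: lp_ext => v; rewrite lphornerE ?coef0// horner0.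
- move=> _ _ [P P0 <-] [Q Q0 <-]; have PQ0 : (P + Q)`_0 = 0 by rewrite coefD P0 Q0 addr0.
  by exists (P + Q) => //; apply: lp_ext => v; rewrite lpDE !lphornerE// hornerD.
- move=> c _ [P P0 <-]; have cP0 : (c *: P)`_0 = 0 by rewrite coefZ P0 mulr0.
  by exists (c *: P) => //; apply: lp_ext => v; rewrite lpZE !lphornerE// hornerZ.
- move=> _ _ [P P0 <-] [Q Q0 <-]; have PQ0 : (P * Q)`_0 = 0 by rewrite coef0M P0 mul0r.
  by exists (P * Q) => //; apply: lp_ext => v; rewrite lpME !lphornerE// hornerM.
Qed.

Lemma mem_generated_subalgebra (f : X) m : (0 < m)%N ->
  generated_subalgebra f (lpexp f m).
Proof. by move=> m0; exists 'X^m; rewrite ?lphornerXn//= coefXn; case: m m0. Qed.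

Lemma generated_subalgebra_sub (S : set X) f : subalgebra S -> S f ->
  generated_subalgebra f `<=` S.
Proof.
move=> [S0 SD SZ SM] Sf _ [P P0 <-].
have Sexp m : S (lpexp f m.+1).
  by elim: m => [//|m IH]; rewrite lpexpS; exact: SM.
rewrite /lphorner; elim/big_ind: _ => // -[[|i] ?] _; first by rewrite P0 scale0r.
by apply: SZ; exact: Sexp i.
Qed.

Lemma lpexp_neq0 (f : X) m : (0 < m)%N -> f <> 0 -> lpexp f m <> 0.
Proof.
move=> m0 f0 fm0; apply: f0; apply: lp_ext => v; apply/eqP.
have : lpexp f m v = 0 by rewrite fm0.
by rewrite lpexpE// => /eqP; rewrite expf_eq0 m0.
Qed.

Lemma nonzero_of_neq_set0 (S : set X) : S 0 -> S <> [set 0] -> exists2 z, S z & z <> 0.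
Proof.
move=> S0 Sn; apply: contrapT => H; apply: Sn; apply/seteqP; split=> [f Sf|f ->//] /=.
by apply: contrapT => f0; apply: H; exists f.
Qed.

Lemma algebra_dense_generators (S : set X) : dense S -> hypercyclic_algebra B S ->
  dense [set f : X | hypercyclic_algebra B (generated_subalgebra f)].
Proof.
move=> dS [Salg Sn0 Shc]; have [S0 _ _ _] := Salg.
have [z _ z0] := nonzero_of_neq_set0 S0 Sn0.
apply/dense_lpnorm => f e e0.
have [g [Sg gf g0]] := dense_avoid (fun _ => 0) 1 dS z0 f e0.
exists g => //; split; first exact: generated_subalgebraP.
  move=> /seteqP[/(_ g)]/=; have := @mem_generated_subalgebra g 1 isT.
  by rewrite [lpexp g 1]/= => h /(_ h)/(g0 0%N isT).
by move=> h /(generated_subalgebra_sub Salg Sg); exact: Shc.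
Qed.

Lemma generators_hc_powers (f : X) :
  hypercyclic_algebra B (generated_subalgebra f) -> hc_powers B f.
Proof.
move=> [alg n0 hc] m m0.
have [|] := hc _ (mem_generated_subalgebra f m0); first by [].
move=> /= fm0; exfalso; apply: n0.
have f0 : f = 0 by apply: contrapT => /(lpexp_neq0 m0).
apply/seteqP; split=> [_ [P P0 <-]|_ ->]; last by have [] := alg.
by apply: lp_ext => v; rewrite lphornerE// f0 lp0E horner_coef0.
Qed.

End Algebras.
End Hypercyclic.

(** * Ancestors and path weights in the tree *)

Section Tree.
Variables (A : countType) (E : rel A).
Hypotheses (Etree : directed_tree E) (Eunrooted : unrooted E).
Local Notation par := (par E).

Lemma edge_par b : E (par b) b.
Proof. exact: (xgetPex b (Eunrooted b)). Qed.

Lemma par_edge a b : E a b -> par b = a.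
Proof. by move=> ab; exact: (tree_parent_uniq Etree) (edge_par b) ab. Qed.

Lemma edgeE a b : E a b = (par b == a).
Proof. by apply/idP/eqP => [/par_edge//|<-]; exact: edge_par. Qed.

Lemma ChinE n v u : Chin E n v u <-> iter n par u = v.
Proof.
elim: n u => [|n IH] u //=.
rewrite -iterS iterSr; split=> [[w /IH nw /par_edge ->]//|nu].
by exists (par u); [exact/IH|exact: edge_par].
Qed.

(** The shortest return of [v] to itself along [par], read backwards, would be a
    directed cycle. *)
Lemma iter_par_neq n v : (0 < n)%N -> iter n par v <> v.
Proof.
move=> n0 nv.
have [k /andP[k0 /eqP kv] kmin] : exists2 k, (0 < k)%N && (iter k par v == v) &
    forall j, (0 < j)%N && (iter j par v == v) -> (k <= j)%N.
  have ex : exists k, (0 < k)%N && (iter k par v == v) by exists n; rewrite n0 nv eqxx.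
  by exists (ex_minn ex); case: ex_minnP.
case: k k0 kv kmin => // k _ kv kmin.
apply: (tree_acyclic Etree (s := rev (traject par v k.+1))).
  by move/(congr1 size); rewrite size_rev size_traject.
apply/andP; split; last first.
  rewrite rev_uniq looping_uniq; apply/negP => /trajectP[i ik ki].
  have /kmin : (0 < k.+1 - (k - i))%N && (iter (k.+1 - (k - i)) par v == v).
    rewrite subn_gt0 ltnS leq_subr/=.
    have -> : (k.+1 - (k - i) = i.+1)%N by rewrite subSn ?leq_subr// subKn// ltnW.
    by rewrite iterS -ki -iterS kv.
  rewrite leqNgt; have -> // : (k.+1 - (k - i) < k.+1)%N.
  by rewrite subSn ?leq_subr// ltnS subKn// ltnW.
rewrite rev_cycle trajectS /= rcons_path.
have -> : last v (traject par (par v) k) = iter k par v.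
  by case: (k) => // j; rewrite trajectSr last_rcons -iterSr.
have -> : E v (iter k par v) by rewrite -[X in E X _]kv iterS edge_par.
rewrite andbT.
elim: k {kv kmin} (v) => //= k IH w.
by rewrite edge_par IH.
Qed.

Lemma iter_par_inj m n u v : iter m par u = v -> iter n par u = v -> m = n.
Proof.
have H a b : (a < b)%N -> iter a par u = v -> iter b par u = v -> False.
  move=> ab ua ub; apply: (@iter_par_neq (b - a) v); first by rewrite subn_gt0.
  by rewrite -{1}ua -iterD subnK// ltnW.
by move=> um un; have [/H h|/H h|//] := ltngtP m n; exfalso; exact: h.
Qed.

(** Two vertices are related by at most one number of generations, and a finite set
    contains finitely many pairs. *)
Lemma par_escape (F : seq A) : exists N, forall n u v, (N <= n)%N ->
  u \in F -> v \in F -> iter n par u <> v.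
Proof.
have one u v : exists N, forall n, (N <= n)%N -> iter n par u <> v.
  have [[k kv]|H] := pselect (exists k, iter k par u = v).
    by exists k.+1 => n kn /(iter_par_inj kv) nk; rewrite nk ltnn in kn.
  by exists 0%N => n _ nv; apply: H; exists n.
have two u (G : seq A) : exists N, forall n v, (N <= n)%N -> v \in G -> iter n par u <> v.
  elim: G => [|v G [N NP]]; first by exists 0%N.
  have [M MP] := one u v; exists (maxn N M) => n w; rewrite geq_max => /andP[Nn Mn].
  by rewrite in_cons => /orP[/eqP ->|]; [exact: MP|exact: NP].
suff H (G : seq A) : exists N, forall n u v, (N <= n)%N ->
    u \in G -> v \in F -> iter n par u <> v by exact: H.
elim: G => [|u G [N NP]]; first by exists 0%N.
have [M MP] := two u F; exists (maxn N M) => n x v; rewrite geq_max => /andP[Nn Mn].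
by rewrite in_cons => /orP[/eqP ->|]; [exact: MP|exact: NP].
Qed.

Variables (R : realType) (lambda : A -> R[i]).
Hypothesis lambda_neq0 : forall v, lambda v != 0.
Local Notation w := (path_weight E lambda).

Lemma path_weight0 u : w 0 u = 1. Proof. by rewrite /path_weight big_ord0. Qed.

Lemma path_weightS n u : w n.+1 u = lambda u * w n (par u).
Proof.
rewrite /path_weight big_ord_recl; congr (_ * _).
by apply: eq_bigr => i _; rewrite -iterSr.
Qed.

Lemma path_weightD m n u : w (m + n) u = w m u * w n (iter m par u).
Proof.
elim: m u => [|m IH] u; first by rewrite path_weight0 mul1r.
by rewrite addSn !path_weightS IH iterSr mulrA.
Qed.

Lemma cmod_gt0 (z : R[i]) : z != 0 -> 0 < cmod z.
Proof.
move=> z0; rewrite lt_neqAle cmod_ge0 andbT eq_sym.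
by apply: contra z0 => /eqP /Normc.eq0_normc ->.
Qed.

Lemma path_weight_neq0 n u : w n u != 0.
Proof. by apply/prodf_neq0 => i _. Qed.

Lemma cmod_path_weight_gt0 n u : 0 < cmod (w n u).
Proof. exact: cmod_gt0 (path_weight_neq0 n u). Qed.

(** [Rs] has one vertex in each class of vertices of [F] that share a [k]-th
    ancestor for some [k]. Beyond this ancestor the paths coincide, so the ratio
    [w n v / w n r] is the constant [w k v / w k r], which [C] bounds. *)
Lemma representatives (F : seq A) : exists (Rs : seq A) (C : R) (N : nat),
  [/\ {subset Rs <= F}, 0 < C,
      forall r r', r \in Rs -> r' \in Rs -> forall n, iter n par r = iter n par r' -> r = r' &
      forall v, v \in F -> exists2 r, r \in Rs & forall n, (N <= n)%N ->
        iter n par v = iter n par r /\ cmod (w n v) <= C * cmod (w n r)].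
Proof.
elim: F => [|v F [Rs [C [N [RF C0 Runiq RP]]]]].
  by exists [::], 1, 0%N; split.
have [[k [r rR vr]]|nR] := pselect (exists k, exists2 r, r \in Rs & iter k par v = iter k par r).
  pose c := cmod (w k v) / cmod (w k r).
  have c0 : 0 < c by rewrite divr_gt0 ?cmod_path_weight_gt0.
  exists Rs, (Num.max C c), (maxn N k); split => //.
  - by move=> x /RF xF; rewrite in_cons xF orbT.
  - by rewrite lt_max C0.
  move=> x; rewrite in_cons => /orP[/eqP ->|xF].
    exists r => // n; rewrite geq_max => /andP[_ kn].
    rewrite -(subnKC kn) !path_weightD !Normc.normcM.
    rewrite [(k + _)%N]addnC !iterD vr; split => //.
    rewrite mulrA ler_wpM2r ?cmod_ge0//.
    apply: (@le_trans _ _ (c * cmod (w k r))).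
      by rewrite /c divfK// gt_eqF// cmod_path_weight_gt0.
    by rewrite ler_wpM2r ?cmod_ge0// le_max lexx orbT.
  have [r' r'R r'P] := RP x xF; exists r' => // n.
  rewrite geq_max => /andP[Nn _]; have [-> xr'] := r'P n Nn; split => //.
  by apply: le_trans xr' _; rewrite ler_wpM2r ?cmod_ge0// le_max lexx.
exists (v :: Rs), (Num.max C 1), N; split.
- by move=> x; rewrite !in_cons => /orP[->//|/RF ->]; rewrite orbT.
- by rewrite lt_max C0.
- move=> r r'; rewrite !in_cons => /orP[/eqP->|rR] /orP[/eqP->|r'R] n rr' //.
  + by exfalso; apply: nR; exists n, r'.
  + by exfalso; apply: nR; exists n, r.
  + exact: Runiq rr'.
move=> x; rewrite in_cons => /orP[/eqP ->|xF].
  exists v; first exact: mem_head.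
  move=> n _; split => //; rewrite -[leLHS]mul1r ler_wpM2r ?cmod_ge0//.
  by rewrite le_max lexx orbT.
have [r rR rP] := RP x xF; exists r; first by rewrite in_cons rR orbT.
move=> n Nn; have [-> xr] := rP n Nn; split => //.
by apply: le_trans xr _; rewrite ler_wpM2r ?cmod_ge0// le_max lexx.
Qed.

End Tree.

(** * Iterates of the weighted backward shift *)

Section Operator.
Variables (R : realType) (A : countType) (E : rel A).
Hypotheses (Etree : directed_tree E) (Eunrooted : unrooted E).
Variables (p : R) (p1 : 1 <= p) (lambda : A -> R[i]).
Local Notation X := (lpspace A p1).
Variable B : X -> X.
Hypothesis Bshift : weighted_backward_shift E lambda B.
Local Notation par := (par E).
Local Notation w := (path_weight E lambda).

Let totally_proper : ProperFilter (@totally A). Proof. exact: totally_filter. Qed.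
Let totally_filt : Filter (@totally A). Proof. exact: filter_filter. Qed.
#[local] Existing Instance totally_proper.
#[local] Existing Instance totally_filt.

Lemma totally_cvg_unique (F : finmap.finset_of (Phant A) -> R[i]^o) (a b : R[i]^o) :
  F @ totally --> a -> F @ totally --> b -> a = b.
Proof.
have FF : ProperFilter (F @ @totally A) by exact: fmap_proper_filter.
exact: (@cvg_unique R[i]^o (@norm_hausdorff _ R[i]^o) _ FF).
Qed.

Lemma partial_sum_seq (x : A -> R[i]) (J : finmap.finset_of (Phant A)) :
  partial_sum x J = \sum_(i <- finmap.enum_fset J) x i.
Proof. by rewrite /partial_sum finmap.big_seq_fsetE. Qed.

(** Uniqueness of the limits that define [B f v] makes [B] linear. *)
Lemma shift_linear (a : R[i]) (f g : X) : B (a *: f + g) = a *: B f + B g.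
Proof.
apply: lp_ext => v; rewrite lpDE lpZE.
pose s (h : X) u : R[i] := if E v u then lambda u * h u else 0.
have lim : partial_sum (s (a *: f + g)) @ totally --> (a * B f v + B g v : R[i]^o).
  have -> : partial_sum (s (a *: f + g)) =
      (a \*: partial_sum (s f)) \+ partial_sum (s g).
    apply/funext => J /=; rewrite !partial_sum_seq scaler_sumr -big_split/=.
    apply: eq_bigr => u _; rewrite /s lpDE lpZE; case: ifP => _.
      by rewrite mulrDr mulrCA.
    by rewrite scaler0 addr0.
  have Hf := @Bshift f v; have Hg := @Bshift g v.
  have Haf := @cvgZl_tmp _ R[i]^o _ _ totally_filt a _ _ Hf.
  exact: (@cvgD _ R[i]^o _ _ totally_filt _ _ _ _ Haf Hg).
exact: totally_cvg_unique (@Bshift (a *: f + g) v) lim.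
Qed.

Lemma shift_delta u : B (lpdelta p1 u) = lambda u *: lpdelta p1 (par u).
Proof.
apply: lp_ext => v; rewrite lpZE lpdeltaE.
have lim : partial_sum (fun x => if E v x then lambda x * lpdelta p1 u x else 0)
    @ totally --> (lambda u * (v == par u)%:R : R[i]^o).
  apply: (@cvg_near_cst _ R[i]^o _ _ _ totally_filt).
  exists (finmap.fset1 u) => //= J /= /finmap.fsubsetP uJ.
  rewrite partial_sum_seq (bigD1_seq u)/=; last 2 first.
  - by apply: uJ; rewrite finmap.in_fset1.
  - exact: finmap.fset_uniq.
  rewrite big1 => [|x /negbTE xu]; last by rewrite lpdeltaE xu mulr0 if_same.
  by rewrite addr0 lpdeltaE eqxx (edgeE Etree Eunrooted) eq_sym; case: eqP; rewrite ?mulr0.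
exact: totally_cvg_unique (@Bshift (lpdelta p1 u) v) lim.
Qed.

Lemma shift0 : B 0 = 0.
Proof.
have := shift_linear (-1) 0 0; rewrite scaler0 addr0 scaleN1r => ->.
by rewrite addNr.
Qed.

Lemma iter_shift_linear n (a : R[i]) (f g : X) :
  iter n B (a *: f + g) = a *: iter n B f + iter n B g.
Proof. by elim: n => [//|n IH]; rewrite !iterS IH shift_linear. Qed.

Lemma iter_shift0 n : iter n B 0 = 0.
Proof. by elim: n => [//|n IH]; rewrite iterS IH shift0. Qed.

Lemma iter_shiftD n (f g : X) : iter n B (f + g) = iter n B f + iter n B g.
Proof. by have := iter_shift_linear n 1 f g; rewrite !scale1r. Qed.

Lemma iter_shiftZ n a (f : X) : iter n B (a *: f) = a *: iter n B f.
Proof. by have := iter_shift_linear n a f 0; rewrite iter_shift0 !addr0. Qed.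

Lemma iter_shift_sum n (I : Type) (r : seq I) (F : I -> X) :
  iter n B (\sum_(i <- r) F i) = \sum_(i <- r) iter n B (F i).
Proof. exact: (big_morph _ (iter_shiftD n) (iter_shift0 n)). Qed.

Lemma iter_shift_delta n u : iter n B (lpdelta p1 u) = w n u *: lpdelta p1 (iter n par u).
Proof.
elim: n u => [|n IH] u; first by rewrite path_weight0 scale1r.
by rewrite iterSr shift_delta iter_shiftZ IH scalerA -path_weightS -iterSr.
Qed.

Lemma iter_shift_fin n s (c : A -> R[i]) y : iter n B (lpfin p1 s c) y =
  \sum_(a <- undup s) c a * (w n a * (y == iter n par a)%:R).
Proof.
rewrite /lpfin iter_shift_sum lp_bigE; apply: eq_bigr => a _.
by rewrite iter_shiftZ iter_shift_delta !lpZE lpdeltaE.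
Qed.

Hypothesis Bbounded : bounded_operator B.

Lemma shift_lip : exists2 K : R, 1 <= K &
  forall f g : X, lpnorm (B f - B g) <= K * lpnorm (f - g).
Proof.
have [M MP] := Bbounded; exists (Num.max 1 M); first by rewrite le_max lexx.
move=> f g; have -> : B f - B g = B (f - g).
  by rewrite [f - g]addrC -[- g]scaleN1r shift_linear scaleN1r addrC.
apply: le_trans (MP _) _; apply: ler_wpM2r; first exact: lpnorm_ge0.
by rewrite le_max lexx orbT.
Qed.

Section Estimates.
Variable K : R.
Hypothesis K1 : 1 <= K.
Hypothesis B_lip : forall f g : X, lpnorm (B f - B g) <= K * lpnorm (f - g).

Let K0 : 0 < K. Proof. exact: lt_le_trans K1. Qed.

(** [w n u] is the only nonzero coordinate of [B^n e_u], and [e_u] is a unit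
    vector. *)
Lemma path_weight_le n u : cmod (w n u) <= K ^+ n.
Proof.
have := iter_lip K0 B_lip n (lpdelta p1 u) 0; rewrite iter_shift0 !subr0 => H.
have : cmod (iter n B (lpdelta p1 u) (iter n par u)) <= K ^+ n.
  apply: le_trans (cmod_le_lpnorm _ _) _; apply: le_trans H _.
  rewrite -[leRHS]mulr1; apply: ler_wpM2l; first by rewrite exprn_ge0 ?ltW.
  exact: lpnorm_delta.
by rewrite iter_shift_delta lpZE lpdeltaE eqxx mulr1.
Qed.

(** For a finitely supported [g] this is the triangle inequality in
    [(B^n g)(y) = sum of w_n(u) g(u)] over the [u] with [par^n u = y]. The general
    case follows by truncating [g], as [B^n] is continuous. *)
Lemma iter_shift_coord_le (g : X) n y (S T : R) : 0 <= S ->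
  (forall u, iter n par u = y -> cmod (w n u) <= S) ->
  (forall s, uniq s -> {in s, forall a, iter n par a = y} ->
     \sum_(a <- s) cmod (g a) <= T) ->
  cmod (iter n B g y) <= S * T.
Proof.
move=> S0 wS gT; apply/ler_addgt0Pr => e e0.
have Kn : 0 < K ^+ n by rewrite exprn_gt0.
have [s sP] := @lp_trunc_approx _ _ _ p1 g _ (divr_gt0 e0 Kn).
have -> : iter n B g y = iter n B (lpfin p1 s g) y + (iter n B g - iter n B (lpfin p1 s g)) y.
  by rewrite lpBE addrCA subrr addr0.
apply: le_trans (le_normcD _ _) _; apply: lerD; last first.
  apply: le_trans (cmod_le_lpnorm _ _) _; apply: le_trans (iter_lip K0 B_lip _ _ _) _.
  by rewrite -ler_pdivlMl// mulrC.
rewrite iter_shift_fin.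
apply: le_trans (cmod_sum_le _ _) _.
rewrite (eq_bigr (fun a => if iter n par a == y then cmod (g a) * cmod (w n a) else 0)); last first.
  move=> a _; rewrite eq_sym; case: eqP => _; last by rewrite !mulr0 Normc.normc0.
  by rewrite mulr1 Normc.normcM.
rewrite -big_mkcond -big_filter; set r := [seq _ <- _ | _].
have rP : {in r, forall a, iter n par a = y} by move=> a; rewrite mem_filter => /andP[/eqP].
apply: (@le_trans _ _ (\sum_(a <- r) cmod (g a) * S)).
  rewrite big_seq [leRHS]big_seq; apply: ler_sum => a ar.
  by rewrite ler_wpM2l ?cmod_ge0// wS// rP.
rewrite -mulr_suml mulrC ler_wpM2l// gT//.
by rewrite filter_uniq ?undup_uniq.
Qed.

End Estimates.
End Operator.

(** * The weight condition on finite sets of vertices *)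

Section Condition.
Variables (R : realType) (A : countType) (E : rel A).
Hypotheses (Etree : directed_tree E) (Eunrooted : unrooted E).
Variable lambda : A -> R[i].
Hypothesis lambda_neq0 : forall v, lambda v != 0.
Local Notation par := (par E).
Local Notation w := (path_weight E lambda).

Definition expanding n (M : R) v := exists2 u, iter n par u = v & M < cmod (w n u).

Definition dominated n (M : R) v := M * cmod (w n v) < 1 \/
  exists2 u, iter n par u = iter n par v & M * cmod (w n v) < cmod (w n u).

Definition uniform_condition := forall (F : seq A) (M : R), exists n,
  {in F, forall v, expanding n M v /\ dominated n M v}.

Lemma expandingE n M v : expanding n M v <->
  (M%:E < ereal_sup [set (cmod (w n u))%:E | u in Chin E n v])%E.
Proof.
split=> [[u /(ChinE Etree Eunrooted) uv Mu]|].
  by apply: lt_le_trans (ereal_sup_ubound _); last (by exists u); rewrite lte_fin.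
move=> /ereal_sup_gt[_ [u /(ChinE Etree Eunrooted) uv <-]].
by rewrite lte_fin; exists u.
Qed.

Lemma dominatedE n M v : dominated n M v <->
  (M%:E < maxe ((cmod (w n v))^-1)%:E
    (ereal_sup [set (cmod (w n u) / cmod (w n v))%:E | u in Chin E n (iter n par v)]))%E.
Proof.
have wv := cmod_path_weight_gt0 E lambda_neq0 n v.
rewrite lt_max lte_fin; split=> [[Mv|[u /(ChinE Etree Eunrooted) uv Mu]]|/orP[]].
- by rewrite -[(cmod _)^-1]mul1r ltr_pdivlMr// Mv.
- apply/orP; right; apply: lt_le_trans (ereal_sup_ubound _); last by exists u.
  by rewrite lte_fin ltr_pdivlMr.
- by rewrite -[(cmod _)^-1]mul1r ltr_pdivlMr//; left.
- move=> /ereal_sup_gt[_ [u /(ChinE Etree Eunrooted) uv <-]].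
  by rewrite lte_fin ltr_pdivlMr//; right; exists u.
Qed.

(** From the uniform condition, [n_ k] is chosen for the first [k] vertices and the
    bound [k]; conversely, finitely many vertices are dealt with by one large [k]. *)
Lemma uniform_conditionP : uniform_condition <->
  exists n_ : nat -> nat, forall v : A,
    (ereal_sup [set (cmod (w (n_ k) u))%:E | u in Chin E (n_ k) v] @[k --> \oo] --> +oo)%E /\
    (maxe ((cmod (w (n_ k) v))^-1)%:E
       (ereal_sup [set (cmod (w (n_ k) u) / cmod (w (n_ k) v))%:E |
          u in Chin E (n_ k) (iter (n_ k) par v)])
       @[k --> \oo] --> +oo)%E.
Proof.
split=> [H|[n_ nP] F M]; last first.
  have [N _ NP] : \forall k \near \oo,
      {in F, forall v, expanding (n_ k) M v /\ dominated (n_ k) M v}.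
    elim: F => [|v F IH]; first by near=> k => ?; rewrite in_nil.
    have [/cvgeyPgt/(_ M) v1 /cvgeyPgt/(_ M) v2] := nP v.
    near=> k => x; rewrite in_cons => /orP[/eqP->|].
      by split; [apply/expandingE; near: k|apply/dominatedE; near: k].
    by move: x; near: k.
  by exists (n_ N); apply: NP => /=.
have [n_ nP] := choice (fun k : nat => H (pmap unpickle (iota 0 k)) k%:R).
exists n_ => v.
have large (M : R) : \forall k \near \oo, M <= k%:R /\ v \in pmap unpickle (iota 0 k).
  exists (maxn (Num.bound `|M|) (pickle v).+1) => // k /=.
  rewrite geq_max => /andP[Mk vk]; split.
    apply: le_trans (ler_norm M) _; apply: ltW; apply: lt_le_trans (archi_boundP _) _ => //.
    by rewrite ler_nat.
  by rewrite mem_pmap; apply/mapP; exists (pickle v); rewrite ?mem_iota ?pickleK.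
split; apply/cvgeyPgt => M; apply: filterS (large M) => k [Mk vk];
  have [e d] := nP k v vk.
- by apply: le_lt_trans (_ : (k%:R%:E < _)%E); [rewrite lee_fin|exact/expandingE].
- by apply: le_lt_trans (_ : (k%:R%:E < _)%E); [rewrite lee_fin|exact/dominatedE].
Unshelve. all: by end_near. Qed.

End Condition.

(** * Necessity of the weight condition *)

Section Necessity.
Variables (R : realType) (A : countType) (E : rel A).
Hypotheses (Etree : directed_tree E) (Eunrooted : unrooted E).
Variables (p : R) (p1 : 1 <= p) (lambda : A -> R[i]).
Hypothesis lambda_neq0 : forall v, lambda v != 0.
Local Notation X := (lpspace A p1).
Variable B : X -> X.
Hypothesis Bshift : weighted_backward_shift E lambda B.
Variable K : R.
Hypothesis K1 : 1 <= K.
Hypothesis B_lip : forall f g : X, lpnorm (B f - B g) <= K * lpnorm (f - g).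
Local Notation par := (par E).
Local Notation w := (path_weight E lambda).

(** This is where [p <= m] enters: where [f0] vanishes, [|f| <= 1] and hence
    [|f|^m <= |f - f0|^p]. *)
Lemma power_sum_le (f f0 : X) (m : nat) (d : R) s : p <= m%:R -> 0 <= d <= 1 ->
  lpnorm (f - f0) <= d -> uniq s -> {in s, forall a, f0 a = 0} ->
  \sum_(a <- s) cmod (lpexp f m a) <= d.
Proof.
move=> pm /andP[d0 d1] fd us s0.
have p0 : 0 < p by exact: lt_le_trans p1.
have m0 : (0 < m)%N by rewrite -(ltr_nat R); exact: lt_le_trans pm.
have dp : lpnorm (f - f0) `^ p <= d.
  apply: (@le_trans _ _ (d `^ p)).
    by apply: ge0_ler_powR; [exact: ltW|rewrite nnegrE lpnorm_ge0|rewrite nnegrE|].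
  have [->|dn0] := eqVneq d 0; first by rewrite powR0 ?gt_eqF.
  by apply: ge1r_powR => //; rewrite lt_neqAle eq_sym dn0 d0.
apply: le_trans dp; apply: le_trans (ge_lpnorm_seq (f - f0) us).
rewrite big_seq [leRHS]big_seq; apply: ler_sum => a sa.
have fa : (f - f0) a = f a by rewrite lpBE s0 ?subr0.
rewrite lpexpE// cmodX fa -powR_mulrn ?cmod_ge0//.
have fa1 : cmod (f a) <= 1.
  by rewrite -fa; apply: le_trans (cmod_le_lpnorm _ _) (le_trans fd d1).
have [->|fa0] := eqVneq (cmod (f a)) 0; first by rewrite !powR0 ?gt_eqF ?ltr0n.
by apply: ger_powR => //; rewrite fa1 andbT lt_neqAle eq_sym fa0 cmod_ge0.
Qed.

Lemma quarter_lt1 : 4^-1 < 1 :> R. Proof. lra. Qed.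

Lemma quarters_absurd (t u d : R) :
  0 < u -> u <= t -> d <= u * 4^-1 -> t <= d + 4^-1 * u -> False.
Proof. lra. Qed.

Lemma cmod_near2 (x : R[i]) (d : R) : d <= 4^-1 -> cmod (x - 2) <= d -> 1 <= cmod x.
Proof.
have : cmod 2 <= cmod x + cmod (x - 2).
  rewrite -{1}(subKr x 2); apply: le_trans (le_normcD _ _) _.
  by rewrite normcN.
by rewrite cmod_nat; lra.
Qed.

(** The constant [L] is at least [M], and at least [C M] so that a domination at a
    representative [r] with constant [L] yields one with constant [M] at each [v]
    that [r] represents. With [d = 1/(4 L)], weights bounded by [L] contribute at
    most [1/4] through the mass [d] that [f^m] has off [Rs]. *)
Lemma dense_power_uniform_condition :
  dense [set f : X | exists m : nat, p <= m%:R /\ HC B (lpexp f m)] ->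
  uniform_condition E lambda.
Proof.
move=> /dense_lpnorm dH F M.
have [F0|[v0 v0F]] : F = [::] \/ exists v0, v0 \in F.
  by case: (F) => [|v0 F']; [left|right; exists v0; exact: mem_head].
- by rewrite F0; exists 0%N.
have [Rs [C [N1 [RsF C0 Rsuniq RsP]]]] := representatives E lambda_neq0 F.
have [N2 esc] := par_escape Etree Eunrooted F.
pose M1 := Num.max 1 M; pose L := M1 * Num.max 1 C.
have M11 : 1 <= M1 by rewrite le_max lexx.
have MM1 : M <= M1 by rewrite le_max lexx orbT.
have C1 : 1 <= Num.max 1 C by rewrite le_max lexx.
have CC1 : C <= Num.max 1 C by rewrite le_max lexx orbT.
have M1L : M1 <= L by apply: ler_peMr => //; exact: le_trans M11.
have L1 : 1 <= L by exact: le_trans M11 M1L.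
have ML : M <= L by exact: le_trans MM1 M1L.
have L0 : 0 < L by exact: lt_le_trans L1.
pose d := (4 * L)^-1.
have d0 : 0 < d by rewrite invr_gt0 mulr_gt0.
have Ld : L * d = 4^-1 by rewrite /d invfM mulrCA divff ?mulr1// gt_eqF.
have d14 : d <= 4^-1.
  by rewrite -Ld -[leLHS]mul1r ler_wpM2r// ltW.
have d01 : 0 <= d <= 1 by rewrite ltW//=; exact: le_trans d14 (ltW quarter_lt1).
have [f [m [pm hc]] ff0] := dH (lpfin p1 Rs (fun=> 2)) d d0.
have m0 : (0 < m)%N by rewrite -(ltr_nat R); exact: lt_le_trans ltr01 (le_trans p1 pm).
have v0n0 : lpdelta p1 v0 <> 0.
  by move=> /(congr1 (fun h : X => h v0)); rewrite lpdeltaE eqxx lp0E => /eqP; rewrite oner_eq0.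
have [n nN hn] := dense_orbit_late hc v0n0 (maxn N1 N2) (lpfin p1 F (fun=> 2)) d0.
move: nN; rewrite geq_max => /andP[nN1 nN2].
set h := lpexp f m in hc hn.
have coord y : cmod (iter n B h y - lpfin p1 F (fun=> 2) y) < d.
  by rewrite -lpBE; exact: le_lt_trans (cmod_le_lpnorm _ _) hn.
have sumh s : uniq s -> {in s, forall a, a \notin Rs} -> \sum_(a <- s) cmod (h a) <= d.
  move=> us sR; apply: (power_sum_le pm d01 (ltW ff0) us) => a /sR /negbTE aR.
  by rewrite lpfinE aR.
have hR r : r \in Rs -> 1 <= cmod (h r).
  move=> rR; rewrite /h lpexpE// cmodX exprn_ege1//.
  apply: (cmod_near2 (d := d)) => //.
  have := le_trans (cmod_le_lpnorm (f - lpfin p1 Rs (fun=> 2)) r) (ltW ff0).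
  by rewrite lpBE lpfinE rR.
exists n => v vF; split.
  (* All the mass of [h] over [v] lies off [Rs], as no vertex of [F] is over [v]. *)
  suff [u uv Lu] : expanding E lambda n L v by exists u; rewrite // (le_lt_trans ML).
  apply: contrapT => nexp.
  have : cmod (iter n B h v) <= L * d.
    apply: (iter_shift_coord_le Etree Eunrooted Bshift K1 B_lip (ltW L0)).
      by move=> u uv; rewrite leNgt; apply/negP => Lu; apply: nexp; exists u.
    move=> s us sv; apply: sumh => // a sa; apply/negP => /RsF aF.
    exact: esc nN2 aF vF (sv a sa).
  have : 1 <= cmod (iter n B h v).
    by apply: (cmod_near2 (d := d)) => //; have /ltW := coord v; rewrite lpfinE vF.
  by rewrite Ld => /le_trans H /H; rewrite leNgt quarter_lt1.
have [r rR rP] := RsP v vF; have [vr wvr] := rP n nN1.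
have LM : M * cmod (w n v) <= L * cmod (w n r).
  apply: (@le_trans _ _ (M1 * cmod (w n v))); first by rewrite ler_wpM2r ?cmod_ge0.
  rewrite /L -mulrA ler_wpM2l ?(le_trans ler01)//.
  by apply: le_trans wvr _; rewrite ler_wpM2r ?cmod_ge0.
suff [|[u ur Lu]] : dominated E lambda n L r.
- by left; exact: le_lt_trans LM _.
- by right; exists u; rewrite ?vr//; exact: le_lt_trans LM _.
apply: contrapT => ndom.
have wr1 : 1 <= L * cmod (w n r).
  by rewrite leNgt; apply/negP => H; apply: ndom; left.
have wr u : iter n par u = iter n par r -> cmod (w n u) <= L * cmod (w n r).
  by move=> ur; rewrite leNgt; apply/negP => H; apply: ndom; right; exists u.
have wr0 := cmod_path_weight_gt0 E lambda_neq0 n r.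
set x := iter n par r in wr.
(* Over [x], only [r] belongs to [Rs]: removing its term leaves small mass. *)
pose g : X := h - h r *: lpdelta p1 r.
have gE a : g a = if a == r then 0 else h a.
  rewrite lpBE lpZE lpdeltaE; case: eqP => [->|_]; first by rewrite mulr1 subrr.
  by rewrite mulr0 subr0.
have gx : cmod (iter n B g x) <= L * cmod (w n r) * d.
  apply: (iter_shift_coord_le Etree Eunrooted Bshift K1 B_lip) => //.
    by rewrite mulr_ge0 ?cmod_ge0// ltW.
  move=> s us sx.
  rewrite (eq_bigr (fun a => if a != r then cmod (h a) else 0)); last first.
    by move=> a _; rewrite gE; case: eqP; rewrite ?Normc.normc0.
  rewrite -big_mkcond -big_filter; apply: sumh; first by rewrite filter_uniq.
  move=> a; rewrite mem_filter => /andP[ar sa]; apply/negP => aR.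
  by move: ar; rewrite (Rsuniq a r aR rR n) ?eqxx// sx.
have hx : cmod (iter n B h x) < d.
  have := coord x; rewrite lpfinE ifN ?subr0//.
  by apply/negP => xF; exact: esc nN2 (RsF _ rR) xF (erefl _).
have hgx : iter n B h x = h r * w n r + iter n B g x.
  have -> : h = h r *: lpdelta p1 r + g by rewrite /g addrC subrK.
  rewrite (iter_shiftD Bshift) (iter_shiftZ Bshift) (iter_shift_delta Etree Eunrooted Bshift).
  rewrite lpDE !lpZE !lpdeltaE /x eqxx !mulr1 -/g -/x.
  by rewrite lpDE lpZE lpdeltaE eqxx mulr1 gE eqxx addr0.
have : cmod (h r * w n r) <= d + L * cmod (w n r) * d.
  have -> : h r * w n r = iter n B h x - iter n B g x by rewrite hgx addrK.
  by apply: le_trans (le_normcD _ _) _; rewrite normcN; exact: lerD (ltW hx) gx.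
rewrite Normc.normcM mulrAC Ld => H.
have H1 : cmod (w n r) <= cmod (h r) * cmod (w n r) by rewrite ler_peMl ?cmod_ge0// hR.
have H2 : d <= cmod (w n r) * 4^-1.
  rewrite -Ld mulrA -[leLHS]mul1r ler_wpM2r ?(ltW d0)//.
  by rewrite mulrC.
exact: quarters_absurd wr0 H1 H2 H.
Qed.

End Necessity.

(** * Sufficiency of the weight condition *)

Section Sufficiency.
Variables (R : realType) (A : countType) (E : rel A).
Hypotheses (Etree : directed_tree E) (Eunrooted : unrooted E).
Variables (p : R) (p1 : 1 <= p) (lambda : A -> R[i]).
Hypothesis lambda_neq0 : forall v, lambda v != 0.
Local Notation X := (lpspace A p1).
Variable B : X -> X.
Hypothesis Bshift : weighted_backward_shift E lambda B.
Variable K : R.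
Hypothesis K1 : 1 <= K.
Hypothesis B_lip : forall f g : X, lpnorm (B f - B g) <= K * lpnorm (f - g).
Hypothesis cond : uniform_condition E lambda.
Local Notation par := (par E).
Local Notation w := (path_weight E lambda).

Lemma seq_argmax (T : eqType) (phi : T -> R) (s : seq T) x0 : x0 \in s ->
  exists2 x, x \in s & {in s, forall y, phi y <= phi x}.
Proof.
elim: s x0 => // x s IH _ _; case: s IH => [_|y s IH].
  by exists x; rewrite ?mem_head// => y; rewrite mem_seq1 => /eqP ->.
have [z zs zP] := IH y (mem_head _ _).
have [zx|/ltW xz] := leP (phi z) (phi x).
  exists x; first exact: mem_head.
  by move=> u; rewrite in_cons => /orP[/eqP ->//|/zP /le_trans]; exact.
exists z; first by rewrite in_cons zs orbT.
by move=> u; rewrite in_cons => /orP[/eqP ->//|/zP].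
Qed.

(** The coordinate at [y] of [B^n] applied to the [q]-th power of [f], for [f]
    supported in [F]. *)
Let pushed (F : seq A) (f : A -> R[i]) q n y : R[i] :=
  \sum_(a <- F) f a ^+ q * (w n a * (y == iter n par a)%:R).

Lemma push_le F f q n y (S : R) :
  {in F, forall a, iter n par a = y -> cmod (w n a) <= S} -> 0 <= S ->
  cmod (pushed F f q n y) <= (\sum_(a <- F) cmod (f a) ^+ q) * S.
Proof.
move=> wS S0; apply: le_trans (cmod_sum_le _ _) _.
rewrite mulr_suml big_seq [leRHS]big_seq; apply: ler_sum => a aF.
rewrite !Normc.normcM cmodX cmod_nat ler_wpM2l ?exprn_ge0 ?cmod_ge0//.
by case: eqP => [ya|_]; rewrite ?mulr1 ?mulr0//; exact: wS.
Qed.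

(** In the pair [cb], the first component is the vertex to be charged over [y] and
    the second one the coefficient. For [y] in [F] nothing of [f] arrives at [y],
    and the coefficient produces [h y]. Otherwise let [v] have the largest weight
    among the vertices of [F] over [y]. If this weight is below [1/M], what arrives
    at [y] is negligible and the coefficient is [0]; if not, some [u] over [y] has
    weight above [M |w_n(v)|]. Then [u] is outside [F] by the choice of [v], and
    the cancelling coefficient at [u] is small. *)
Lemma correction (F : seq A) (f h : A -> R[i]) q (d : R) : (0 < q)%N -> 0 < d <= 1 ->
  exists n, (forall u v, u \in F -> v \in F -> iter n par u <> v) /\
    forall y, exists cb : A * R[i], y \in F ++ [seq iter n par a | a <- F] ->
    [/\ cb.2 = 0 \/ (iter n par cb.1 = y /\ cb.1 \notin F), cmod cb.2 <= d &
        cmod (pushed F f q n y + w n cb.1 * cb.2 ^+ q - (if y \in F then h y else 0)) <= d].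
Proof.
move=> q0 /andP[d0 d1].
have dq0 : 0 < d ^+ q by rewrite exprn_gt0.
have dqd : d ^+ q <= d by case: q q0 {dq0} => // q _; rewrite exprS ler_piMr ?exprn_ile1 // ltW.
have [N esc] := par_escape Etree Eunrooted F.
pose Phi := \sum_(a <- F) cmod (f a) ^+ q; pose H := \sum_(a <- F) cmod (h a).
have Phi0 : 0 <= Phi by apply: sumr_ge0 => a _; rewrite exprn_ge0 ?cmod_ge0.
have H0 : 0 <= H by apply: sumr_ge0 => a _; exact: cmod_ge0.
(* The term [K ^+ N] forces [n >= N], as weights of length [n] are at most
   [K ^+ n]; the last term makes the [q]-th powers of the coefficients at most
   [d ^+ q]. *)
pose M := K ^+ N + 1 + (H + Phi) / d ^+ q.
have KN : 0 < K ^+ N by rewrite exprn_gt0// (lt_le_trans ltr01).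
have Q0 : 0 <= (H + Phi) / d ^+ q by rewrite divr_ge0 ?addr_ge0 ?(ltW dq0).
have M1 : 1 <= M by rewrite /M; lra.
have MK : K ^+ N <= M by rewrite /M; lra.
have M0 : 0 < M by exact: lt_le_trans M1.
have MHP : H + Phi <= M * d ^+ q by rewrite -ler_pdivrMr// /M; lra.
have MH : H <= M * d ^+ q by apply: le_trans MHP; rewrite lerDl.
have MP : Phi <= M * d ^+ q by apply: le_trans MHP; rewrite lerDr.
have [n nP] := cond F M.
have nN v : v \in F -> (N <= n)%N.
  move=> /nP[[u _ Mu] _]; rewrite leqNgt; apply/negP => nN.
  have := lt_le_trans Mu (path_weight_le Etree Eunrooted Bshift K1 B_lip n u).
  by rewrite ltNge (le_trans _ MK)// ler_weXn2l// ltnW.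
have escn u v : u \in F -> v \in F -> iter n par u <> v.
  by move=> uF; exact: esc (nN u uF) uF.
exists n; split => // y.
have [yF|yF] := boolP (y \in F).
  have [[u uy Mu] _] := nP y yF.
  have wu : 0 < cmod (w n u) by exact: lt_trans Mu.
  have [|b bE bd] := @small_root _ (h y / w n u) d q q0 (ltW d0).
    rewrite Normc.normcM Normc.normcV ler_pdivrMr//.
    apply: (@le_trans _ _ H).
      by rewrite /H (big_rem y yF)/= lerDl; apply: sumr_ge0 => a _; exact: cmod_ge0.
    by apply: le_trans MH _; rewrite mulrC ler_wpM2l ?ltW.
  exists (u, b) => _; split => //=.
    by right; split=> //; apply/negP => uF; exact: escn uF yF uy.
  have -> : pushed F f q n y = 0.
    rewrite /pushed big_seq big1// => a aF; case: eqP => [/esym ya|_]; last by rewrite !mulr0.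
    by case: (escn a y aF yF ya).
  by rewrite bE mulrCA divff ?mulr1 ?path_weight_neq0// add0r subrr Normc.normc0 ltW.
have [/mapP[v0 v0F yv0]|ynp] := boolP (y \in [seq iter n par a | a <- F]); last first.
  by exists (y, 0); rewrite mem_cat (negbTE yF) (negbTE ynp).
have [|v] := @seq_argmax _ (fun a => cmod (w n a)) [seq a <- F | iter n par a == y] v0.
  by rewrite mem_filter v0F yv0 eqxx.
rewrite mem_filter => /andP[/eqP vy vF] vmax.
have wmax : {in F, forall a, iter n par a = y -> cmod (w n a) <= cmod (w n v)}.
  by move=> a aF ay; apply: vmax; rewrite mem_filter ay eqxx.
have WP := push_le f q wmax (cmod_ge0 _); rewrite -/Phi in WP.
have [_ [small|[u uv Mu]]] := nP v vF.
  exists (y, 0) => _; split => /=; first by left.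
    by rewrite -[leLHS]/(cmod (0 : R[i])) Normc.normc0 ltW.
  rewrite expr0n gtn_eqF// mulr0 subr0 addr0; apply: le_trans WP _; apply: le_trans dqd.
  rewrite -[leRHS]mul1r; apply: (@le_trans _ _ (M * cmod (w n v) * d ^+ q)).
    by rewrite mulrAC ler_wpM2r ?cmod_ge0.
  by apply: ler_wpM2r; [exact: ltW|exact: ltW].
have wu : 0 < cmod (w n u) by apply: le_lt_trans Mu; rewrite mulr_ge0 ?cmod_ge0 ?ltW.
have [|b bE bd] := @small_root _ (- pushed F f q n y / w n u) d q q0 (ltW d0).
  rewrite Normc.normcM normcN Normc.normcV ler_pdivrMr//; apply: le_trans WP _.
  apply: (@le_trans _ _ (d ^+ q * (M * cmod (w n v)))).
    by rewrite mulrA [d ^+ q * M]mulrC ler_wpM2r ?cmod_ge0.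
  by rewrite ler_wpM2l ?ltW.
exists (u, b) => _; split => //=.
  right; rewrite uv; split=> //; apply/negP => uF.
  have := wmax u uF (etrans uv vy); rewrite leNgt (le_lt_trans _ Mu)//.
  by rewrite ler_peMl ?cmod_ge0.
by rewrite bE mulrCA divff ?mulr1 ?path_weight_neq0// addrN subr0 Normc.normc0 ltW.
Qed.

(** The basis vectors added with a nonzero coefficient are at distinct vertices
    outside [F], whence
    [g^q = f^q + sum of beta_y^q e_(c_y)] and [B^n(g^q) - h] is supported in the
    finite set [Y], with small coordinates there. *)
Lemma hit_finite (F : seq A) (f h : A -> R[i]) m (e : R) : uniq F -> 0 < e ->
  exists (g : X) n, lpnorm (g - lpfin p1 F f) < e /\
    lpnorm (iter n B (lpexp g m.+1) - lpfin p1 F h) < e.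
Proof.
move=> uF e0; pose q := m.+1; pose L : R := (size F + size F)%:R.
have L0 : 0 <= L by exact: ler0n.
pose d := Num.min 1 (e / (L + 1)).
have d0 : 0 < d by rewrite lt_min ltr01 divr_gt0// ltr_wpDl.
have d01 : 0 < d <= 1 by rewrite d0 ge_min lexx.
have Ld : L * d < e.
  have : d <= e / (L + 1) by rewrite ge_min lexx orbT.
  rewrite ler_pdivlMr ?ltr_wpDl// => H; apply: lt_le_trans H.
  by rewrite mulrC ltr_pM2l// ltrDl.
have [n [esc /choice[cb cbP]]] := correction F f h (isT : (0 < q)%N) d01.
set Y := undup (F ++ [seq iter n par a | a <- F]).
have uY : uniq Y by exact: undup_uniq.
have sY : (size Y)%:R * d < e.
  apply: le_lt_trans Ld; apply: ler_wpM2r; first exact: ltW.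
  by rewrite ler_nat; apply: leq_trans (size_undup _) _; rewrite size_cat size_map.
have {}cbP y : y \in Y -> [/\ (cb y).2 = 0 \/ (iter n par (cb y).1 = y /\ (cb y).1 \notin F),
    cmod (cb y).2 <= d &
    cmod (pushed F f q n y + w n (cb y).1 * (cb y).2 ^+ q - (if y \in F then h y else 0)) <= d].
  by rewrite mem_undup; exact: cbP.
pose comb k : X := \sum_(y <- Y) (cb y).2 ^+ k *: lpdelta p1 (cb y).1.
(* At [v], only the summand of [y = par^n v] can be nonzero, because [(cb y).1]
   lies over [y]. *)
have combE k v : (0 < k)%N -> comb k v =
    if (v \notin F) && (iter n par v \in Y) && (v == (cb (iter n par v)).1)
    then (cb (iter n par v)).2 ^+ k else 0.
  move=> k0; rewrite /comb lp_bigE.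
  have zero y : y \in Y -> ~~ [&& v \notin F, iter n par v == y & v == (cb y).1] ->
      ((cb y).2 ^+ k *: lpdelta p1 (cb y).1) v = 0.
    move=> yY; rewrite lpZE lpdeltaE; have [[->|[cy cF]] _ _] := cbP y yY.
      by rewrite expr0n gtn_eqF// mul0r.
    by case: (v =P (cb y).1) => [->|]; rewrite ?mulr0// cy cF eqxx.
  have [vY|vY] := boolP (iter n par v \in Y); last first.
    rewrite andbF /= big_seq big1// => y yY; apply: zero => //.
    by apply/negP => /and3P[_ /eqP vy _]; rewrite vy yY in vY.
  rewrite (bigD1_seq _ vY uY)/= big_seq_cond big1 ?addr0; last first.
    by move=> y /andP[yY yv]; apply: zero => //; rewrite eq_sym (negbTE yv) andbF.
  case: ifP => [/andP[_ vc]|H].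
    by rewrite lpZE lpdeltaE vc mulr1.
  by apply: zero => //; move/negbT: H; rewrite andbT eqxx.
pose g := lpfin p1 F f + comb 1%N.
have gq : lpexp g q = lpfin p1 F (fun a => f a ^+ q) + comb q.
  apply: lp_ext => v; rewrite lpexpE// !lpDE !lpfinE !combE//.
  case: ifP => vF /=; first by rewrite !addr0.
  by rewrite !add0r; case: ifP; rewrite ?expr1// expr0n.
exists g, n; split.
  rewrite /g addrAC subrr add0r; apply: le_lt_trans sY.
  apply: le_trans (lpnorm_sum _ _) _.
  apply: (@le_trans _ _ (\sum_(y <- Y) d)).
    rewrite big_seq [leRHS]big_seq; apply: ler_sum => y /cbP[_ bd _].
    rewrite lpnormZ expr1 -[leRHS]mulr1.
    by apply: ler_pM; rewrite ?cmod_ge0 ?lpnorm_ge0// lpnorm_delta.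
  by rewrite big_const_seq count_predT iter_addr_0 -[leLHS]mulr_natl.
rewrite gq (iter_shiftD Bshift).
have -> : iter n B (lpfin p1 F (fun a => f a ^+ q)) + iter n B (comb q) - lpfin p1 F h =
    lpfin p1 Y (fun y =>
      pushed F f q n y + w n (cb y).1 * (cb y).2 ^+ q - (if y \in F then h y else 0)).
  apply: lp_ext => y; rewrite lpBE lpDE (iter_shift_fin Etree Eunrooted Bshift) undup_id// !lpfinE.
  rewrite -/(pushed F f q n y) /comb (iter_shift_sum Bshift) lp_bigE.
  have termE z : z \in Y -> iter n B ((cb z).2 ^+ q *: lpdelta p1 (cb z).1) y =
      if z == y then w n (cb z).1 * (cb z).2 ^+ q else 0.
    move=> zY; rewrite (iter_shiftZ Bshift) (iter_shift_delta Etree Eunrooted Bshift).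
    rewrite !lpZE lpdeltaE; have [[->|[-> _]] _ _] := cbP z zY.
      by rewrite expr0n mul0r mulr0 if_same.
    by rewrite eq_sym; case: eqP => _; rewrite ?mulr1 ?mulr0// mulrC.
  rewrite big_seq (eq_bigr _ termE) -big_seq.
  have [yY|/negbTE yY] := boolP (y \in Y).
    by rewrite (bigD1_seq y)//= eqxx big1 ?addr0// => z /negbTE ->.
  have yF : y \in F = false.
    by apply: contraFF yY => yF; rewrite mem_undup mem_cat yF.
  have -> : pushed F f q n y = 0.
    rewrite /pushed big_seq big1// => a aF; case: eqP => [ya|_]; last by rewrite !mulr0.
    by rewrite ya mem_undup mem_cat (map_f (fun a => iter n par a) aF) orbT in yY.
  rewrite yF subr0 add0r big_seq big1// => z zY.
  by case: eqP => // zy; move: yY; rewrite -zy zY.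
by apply: le_lt_trans sY; apply: lpnorm_fin_le => y /cbP[].
Qed.

Lemma uniform_condition_hits m (h : X) d : 0 < d -> dense (hits B m h d).
Proof.
move=> d0; apply/dense_lpnorm => f e e0.
have e2 : 0 < e / 2 by rewrite divr_gt0.
have d2 : 0 < d / 2 by rewrite divr_gt0.
have [s1 s1P] := lp_fin_dense f e2; have [s2 s2P] := lp_fin_dense h d2.
pose F := undup (s1 ++ s2).
have ext s (k : X) : {subset s <= F} -> lpfin p1 F (lpfin p1 s k) = lpfin p1 s k.
  move=> sF; apply: lp_ext => v; rewrite lpfinE; case: ifP => // vF.
  by rewrite lpfinE ifN//; apply: contraFN vF; exact: sF.
have F1 : {subset s1 <= F} by move=> v vs; rewrite mem_undup mem_cat vs.
have F2 : {subset s2 <= F} by move=> v vs; rewrite mem_undup mem_cat vs orbT.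
have ed : 0 < Num.min (e / 2) (d / 2) by rewrite lt_min e2.
have [g [n [gf gh]]] := hit_finite (lpfin p1 s1 f) (lpfin p1 s2 h) m (undup_uniq _ : uniq F) ed.
rewrite !ext// in gf gh.
exists g.
  exists n; apply: le_lt_trans (lpnorm_dist3 (lpfin p1 s2 h) _ _) _.
  rewrite (splitr d); apply: ltrD s2P; apply: lt_le_trans gh _.
  by rewrite ge_min lexx orbT.
apply: le_lt_trans (lpnorm_dist3 (lpfin p1 s1 f) _ _) _.
rewrite (splitr e); apply: ltrD s1P; apply: lt_le_trans gf _.
by rewrite ge_min lexx.
Qed.

End Sufficiency.

(** * Equivalence of the assertions *)

Theorem theorem4p1 (R : realType) (A : countType) (E : rel A)
  (Etree : directed_tree E) (Eunrooted : unrooted E) (Eleafless : leafless E)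
  (p : R) (p1 : 1 <= p)
  (lambda : A -> R[i]) (lambda_neq0 : forall v : A, lambda v != 0)
  (B : lpspace A p1 -> lpspace A p1)
  (Bshift : weighted_backward_shift E lambda B) (Bbounded : bounded_operator B) :
  let assertion_i := exists S : set (lpspace A p1), dense S /\ hypercyclic_algebra B S in
  let assertion_ii := dense [set f : lpspace A p1 |
    hypercyclic_algebra B (generated_subalgebra f)] in
  let assertion_iii := residual [set f : lpspace A p1 |
    forall m : nat, (1 <= m)%N -> HC B (lpexp f m)] in
  let assertion_iv := dense [set f : lpspace A p1 |
    exists m : nat, p <= m%:R /\ HC B (lpexp f m)] in
  let assertion_v := exists n_ : nat -> nat, forall v : A,
    (ereal_sup [set (cmod (path_weight E lambda (n_ k) u))%:E |
        u in Chin E (n_ k) v] @[k --> \oo] --> +oo)%E /\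
    (maxe
       ((cmod (path_weight E lambda (n_ k) v))^-1)%:E
       (ereal_sup [set (cmod (path_weight E lambda (n_ k) u) /
                        cmod (path_weight E lambda (n_ k) v))%:E |
          u in Chin E (n_ k) (iter (n_ k) (par E) v)])
       @[k --> \oo] --> +oo)%E in
  [/\ assertion_i -> assertion_ii, assertion_ii -> assertion_iii,
      assertion_iii <-> assertion_iv & assertion_iv <-> assertion_v].
Proof.
have [K K1 B_lip] := shift_lip Bshift Bbounded.
have K0 : 0 < K by exact: lt_le_trans K1.
move=> assertion_i assertion_ii assertion_iii assertion_iv assertion_v.
have residual_dense (S : set (lpspace A p1)) : residual S -> dense S.
  move=> [G [_ dG GS]] O On0 oO.
  by have [f [Of Gf]] := dG O On0 oO; exists f; split => //; exact: GS.
have ii_dense : assertion_ii -> dense (hc_powers B).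
  move=> dii O On0 oO; have [f [Of fgen]] := dii O On0 oO.
  by exists f; split => //; exact: generators_hc_powers.
have iii_iv : assertion_iii -> assertion_iv.
  move=> /residual_dense diii O On0 oO; have [f [Of fhc]] := diii O On0 oO.
  exists f; split => //; exists (Num.bound p).
  have pm : p < (Num.bound p)%:R by apply: archi_boundP; exact: le_trans ler01 p1.
  split; first exact: ltW.
  by apply: fhc; rewrite -(ltr_nat R); exact: lt_trans (lt_le_trans ltr01 p1) pm.
have iv_v : assertion_iv -> assertion_v.
  move=> div; apply/(uniform_conditionP Etree Eunrooted lambda_neq0).
  exact: (dense_power_uniform_condition Etree Eunrooted lambda_neq0 Bshift K1 B_lip div).
have v_iii : assertion_v -> assertion_iii.
  move=> /(uniform_conditionP Etree Eunrooted lambda_neq0) cond.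
  apply: (hc_powers_residual K0 B_lip); apply: (hc_powers_dense K0 B_lip) => m h d.
  exact: (uniform_condition_hits Etree Eunrooted lambda_neq0 Bshift K1 B_lip cond).
split.
- by move=> [S [dS Salg]]; exact: algebra_dense_generators dS Salg.
- by move=> /ii_dense; exact: (hc_powers_residual K0 B_lip).
- by split => // /iv_v.
- by split => // /v_iii.
Qed.
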